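(* Let $D_0=\{(x,y)\in\mathbb{R}^2: x^2+y^2<1\}$ be the open unit disk, and let $(u,v)$ be the fibre coordinates corresponding to $(x,y)$ on the slit tangent bundle $T^\circ D_0$. Then $$F(x,y,u,v)=\frac{\sqrt{u^2+v^2}+yu-xv}{2(1-(x^2+y^2))}$$ is a Finsler function on $T^\circ D_0$ whose geodesics are the horocycles of the Poincaré disk with anticlockwise orientation, and the geodesics of the Finsler function $$\bar F(x,y,u,v)=\frac{\sqrt{u^2+v^2}-yu+xv}{2(1-(x^2+y^2))}$$ on $T^\circ D_0$ are the horocycles with clockwise orientation.
   Context: The slit tangent bundle is the tangent bundle with the zero section removed. A Finsler function is a smooth function on the slit tangent bundle, positively homogeneous of degree 1 in $(u,v)$, that is positive and strongly convex. Geodesics of $F$ are the solutions of its Euler-Lagrange equations, considered as oriented paths in $D_0$ (parametrization is disregarded). The horocycles of the Poincaré disk are the circles with centre in $D_0$ that are tangent (internally) to the boundary unit circle $C=\{x^2+y^2=1\}$, with the point of tangency removed. *)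

(* Defs.v *)
From Stdlib Require Import Reals.
From Coquelicot Require Import Coquelicot.
Open Scope R_scope.

(* [Derive] is total (junk where no derivative exists): only values on an open
   set where the existence of the partial derivatives is known are meaningful. *)
Definition fun4 := R -> R -> R -> R -> R.

Definition dX (f : fun4) : fun4 := fun x y u v => Derive (fun s => f s y u v) x.
Definition dY (f : fun4) : fun4 := fun x y u v => Derive (fun s => f x s u v) y.
Definition dU (f : fun4) : fun4 := fun x y u v => Derive (fun s => f x y s v) u.
Definition dV (f : fun4) : fun4 := fun x y u v => Derive (fun s => f x y u s) v.

Definition continuous4 (f : fun4) (x y u v : R) : Prop :=
  continuous (fun p : R * R * R * R => let '(x', y', u', v') := p in f x' y' u' v')
             (x, y, u, v).

Definition ex_partials (f : fun4) (x y u v : R) : Prop :=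
  ex_derive (fun s => f s y u v) x /\ ex_derive (fun s => f x s u v) y /\
  ex_derive (fun s => f x y s v) u /\ ex_derive (fun s => f x y u s) v.

Fixpoint Ck_on (k : nat) (W : R -> R -> R -> R -> Prop) (f : fun4) : Prop :=
  (forall x y u v, W x y u v -> continuous4 f x y u v) /\
  match k with
  | O => True
  | S k' =>
      (forall x y u v, W x y u v -> ex_partials f x y u v) /\
      Ck_on k' W (dX f) /\ Ck_on k' W (dY f) /\
      Ck_on k' W (dU f) /\ Ck_on k' W (dV f)
  end.

Definition smooth_on (W : R -> R -> R -> R -> Prop) (f : fun4) : Prop :=
  forall k, Ck_on k W f.

Definition slit_tangent (D : R -> R -> Prop) (x y u v : R) : Prop :=
  D x y /\ (u, v) <> (0, 0).

(* The fundamental tensor, i.e. the fibre Hessian of F^2/2, is positive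
   definite. *)
Definition strongly_convex_at (F : fun4) (x y u v : R) : Prop :=
  let E : fun4 := fun x y u v => (F x y u v) ^ 2 / 2 in
  forall a b : R, (a, b) <> (0, 0) ->
    0 < dU (dU E) x y u v * a ^ 2 + dU (dV E) x y u v * (a * b)
        + dV (dU E) x y u v * (b * a) + dV (dV E) x y u v * b ^ 2.

Definition finsler (D : R -> R -> Prop) (F : fun4) : Prop :=
  smooth_on (slit_tangent D) F /\
  (forall x y u v l, slit_tangent D x y u v -> 0 < l ->
     F x y (l * u) (l * v) = l * F x y u v) /\
  (forall x y u v, slit_tangent D x y u v -> 0 < F x y u v) /\
  (forall x y u v, slit_tangent D x y u v -> strongly_convex_at F x y u v).

(* A curve defined on the open interval ]lo, hi[, possibly unbounded; the values
   of [cx] and [cy] outside this interval are irrelevant. *)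
Record curve := Curve { cx : R -> R; cy : R -> R; lo : Rbar; hi : Rbar }.

Definition dom (c : curve) (t : R) : Prop :=
  Rbar_lt (lo c) (Finite t) /\ Rbar_lt (Finite t) (hi c).

Definition smooth_curve_fun (c : curve) (f : R -> R) : Prop :=
  forall n t, dom c t -> ex_derive_n f n t.

Definition regular_curve (D : R -> R -> Prop) (c : curve) : Prop :=
  Rbar_lt (lo c) (hi c) /\
  smooth_curve_fun c (cx c) /\ smooth_curve_fun c (cy c) /\
  (forall t, dom c t -> D (cx c t) (cy c t)) /\
  (forall t, dom c t -> (Derive (cx c) t, Derive (cy c) t) <> (0, 0)).

Definition along (f : fun4) (c : curve) (t : R) : R :=
  f (cx c t) (cy c t) (Derive (cx c) t) (Derive (cy c) t).

Definition euler_lagrange (F : fun4) (c : curve) : Prop :=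
  forall t, dom c t ->
    is_derive (along (dU F) c) t (along (dX F) c t) /\
    is_derive (along (dV F) c) t (along (dY F) c t).

Definition geodesic (D : R -> R -> Prop) (F : fun4) (c : curve) : Prop :=
  regular_curve D c /\ euler_lagrange F c.

(* phi is an orientation-preserving change of parameter exhibiting c as a part
   of the oriented path of c'. *)
Definition reparam (phi : R -> R) (c c' : curve) : Prop :=
  smooth_curve_fun c phi /\
  (forall t, dom c t -> 0 < Derive phi t) /\
  (forall t, dom c t -> dom c' (phi t)) /\
  (forall t, dom c t -> cx c t = cx c' (phi t) /\ cy c t = cy c' (phi t)).

Definition subpath (c c' : curve) : Prop := exists phi, reparam phi c c'.

(* Inextendible as an oriented path: whenever c is a part of a geodesic c', it is
   the whole of c', up to change of parameter. *)
Definition maximal_geodesic (D : R -> R -> Prop) (F : fun4) (c : curve) : Prop :=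
  geodesic D F c /\
  forall c' phi, geodesic D F c' -> reparam phi c c' ->
    forall s, dom c' s -> exists t, dom c t /\ phi t = s.

Definition D0 (x y : R) : Prop := x ^ 2 + y ^ 2 < 1.

Definition on_circle (p q r x y : R) : Prop := (x - p) ^ 2 + (y - q) ^ 2 = r ^ 2.

(* The circle of centre (p, q) and radius r touches the unit circle at (a, b),
   and only there, from inside.  The unit circle itself (p = q = 0, r = 1) is
   thereby excluded. *)
Definition internally_tangent (p q r a b : R) : Prop :=
  on_circle 0 0 1 a b /\ on_circle p q r a b /\
  forall x y, on_circle p q r x y -> (x, y) <> (a, b) -> D0 x y.

Record horocycle := Horocycle {
  hp : R; hq : R;  (* centre *)
  hr : R;          (* radius *)
  ha : R; hb : R;  (* point of tangency *)
  h_centre : D0 hp hq;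
  h_radius : 0 < hr;
  h_tangent : internally_tangent hp hq hr ha hb
}.

Definition on_horocycle (h : horocycle) (x y : R) : Prop :=
  on_circle (hp h) (hq h) (hr h) x y /\ (x, y) <> (ha h, hb h).

Definition parametrizes (h : horocycle) (c : curve) : Prop :=
  regular_curve D0 c /\
  forall x y, on_horocycle h x y <-> exists t, dom c t /\ cx c t = x /\ cy c t = y.

(* (c - centre) x c': its sign is the sense of rotation about the centre. *)
Definition rotation (h : horocycle) (c : curve) (t : R) : R :=
  (cx c t - hp h) * Derive (cy c) t - (cy c t - hq h) * Derive (cx c) t.

Definition anticlockwise_horocycle (h : horocycle) (c : curve) : Prop :=
  parametrizes h c /\ forall t, dom c t -> 0 < rotation h c t.

Definition clockwise_horocycle (h : horocycle) (c : curve) : Prop :=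
  parametrizes h c /\ forall t, dom c t -> rotation h c t < 0.

(* The maximal geodesics are exactly the horocycles with the given orientation
   (each of which does occur), and every geodesic is a part of one of them. *)
Definition geodesics_are_horocycles
    (F : fun4) (oriented_horocycle : horocycle -> curve -> Prop) : Prop :=
  (forall c, maximal_geodesic D0 F c <-> exists h, oriented_horocycle h c) /\
  (forall h, exists c, oriented_horocycle h c) /\
  (forall c, geodesic D0 F c ->
     exists h c', oriented_horocycle h c' /\ subpath c c').

Definition F (x y u v : R) : R :=
  (sqrt (u ^ 2 + v ^ 2) + y * u - x * v) / (2 * (1 - (x ^ 2 + y ^ 2))).

Definition Fbar (x y u v : R) : R :=
  (sqrt (u ^ 2 + v ^ 2) - y * u + x * v) / (2 * (1 - (x ^ 2 + y ^ 2))).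

(* Main.v *)
Require Import Defs.
From Stdlib Require Import Reals Lra FunctionalExtensionality.
From Coquelicot Require Import Coquelicot.
Open Scope R_scope.

(** Both functions are members of one family: with a sign [e], [e * e = 1], put
    [G e = (rho + e (y u - x v)) / (2 D)], where [rho = sqrt (u^2 + v^2)] and
    [D = 1 - (x^2 + y^2)].  Then [e = 1] and [e = -1] are the two cases, and
    [e] is the sense of rotation of the geodesics.

    Finsler property.  Positivity is Cauchy-Schwarz, [|y u - x v| < rho] in the
    disk.  The Euclidean norm has fibre Hessian
    [(v a - u b)^2 / rho^3] and the rest of [G e] is linear in the fibre, so the
    fibre Hessian of [(G e)^2 / 2] is a sum of two squares, which vanish together
    only at the zero vector ([fibre_hessian], [G_strongly_convex]).  Smoothness holds
    because [G e] is built from the coordinates by arithmetic and a square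
    root of a positive quantity, and the partial derivatives are built likewise
    ([elementary_Ck]).

    Geodesics.  Write [J = u v' - v u'] along a curve with velocity [(u, v)].  The two
    Euler-Lagrange equations are the components of one scalar
    equation, [J D = 2 e rho^2 (rho + e (y u - x v))]  ([momentum_derive],
    [geodesic_eq_iff]); it says that the signed curvature is
    [2 e (1 + e (y T1 - x T2)) / D], with [T] the unit tangent.  A circle of radius
    [r] through [(x, y)] with tangent [T] and sense of rotation [e] has its centre at
    distance [1 - r] from the origin exactly if [1 / r] is the absolute value of
    this curvature; this circle is a horocycle.  So horocycles satisfy the
    equation ([runs_along_geodesic]).  Conversely, take along any geodesic the
    horocycle that osculates it at time [t]: by the equation its centre and radius
    have derivative zero ([osculating_derive]), so the horocycle does not
    depend on [t], and the geodesic stays on it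
    ([geodesic_runs_along_horocycle]).

    Oriented paths.  Stereographic projection from the tangency point
    identifies a horocycle with the real line by rational formulas.  Read along a
    geodesic it is the increasing change of parameter that exhibits
    the geodesic as a part of the whole horocycle ([stereo_reparam]).  Maximality
    follows: a geodesic extending a full horocycle lies on one horocycle, which
    must be the same one ([horocycle_inclusion]), and by injectivity of the
    projection along the curve no new parameter values can occur
    ([oriented_horocycle_maximal]). *)

(** * Smoothness of elementary functions of four variables *)

(** The class is closed under partial differentiation, so that smoothness to all
    orders reduces to continuity and one derivative.  The side conditions keep
    inverses and square roots away from their singularities on [W]. *)
Inductive elementary (W : R -> R -> R -> R -> Prop) : fun4 -> Prop :=
| elem_const k : elementary W (fun _ _ _ _ => k)
| elem_x : elementary W (fun x _ _ _ => x)
| elem_y : elementary W (fun _ y _ _ => y)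
| elem_u : elementary W (fun _ _ u _ => u)
| elem_v : elementary W (fun _ _ _ v => v)
| elem_plus f g : elementary W f -> elementary W g ->
    elementary W (fun x y u v => f x y u v + g x y u v)
| elem_mult f g : elementary W f -> elementary W g ->
    elementary W (fun x y u v => f x y u v * g x y u v)
| elem_inv f : elementary W f -> (forall x y u v, W x y u v -> f x y u v <> 0) ->
    elementary W (fun x y u v => / f x y u v)
| elem_sqrt f : elementary W f -> (forall x y u v, W x y u v -> 0 < f x y u v) ->
    elementary W (fun x y u v => sqrt (f x y u v)).

Lemma elementary_continuous W f x y u v :
  elementary W f -> W x y u v -> continuous4 f x y u v.
Proof.
intros Hf HW; unfold continuous4.
induction Hf as [k| | | | |f g _ IHf _ IHg|f g _ IHf _ IHg|f _ IHf Hf|f _ IHf Hf].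
- apply continuous_ext with (fun _ => k); [now intros [[[? ?] ?] ?]|].
  apply continuous_const.
- apply continuous_ext with (fun p => fst (fst (fst p)));
    [now intros [[[? ?] ?] ?]|].
  repeat (apply continuous_comp; [|apply continuous_fst]); apply continuous_id.
- apply continuous_ext with (fun p => snd (fst (fst p)));
    [now intros [[[? ?] ?] ?]|].
  apply continuous_comp; [|apply continuous_snd].
  repeat (apply continuous_comp; [|apply continuous_fst]); apply continuous_id.
- apply continuous_ext with (fun p => snd (fst p)); [now intros [[[? ?] ?] ?]|].
  apply continuous_comp; [|apply continuous_snd].
  repeat (apply continuous_comp; [|apply continuous_fst]); apply continuous_id.
- apply continuous_ext with (fun p => snd p); [now intros [[[? ?] ?] ?]|].
  apply continuous_snd.
- eapply continuous_ext; [|exact (continuous_plus _ _ _ IHf IHg)].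
  now intros [[[? ?] ?] ?].
- eapply continuous_ext; [|exact (continuous_mult _ _ _ IHf IHg)].
  now intros [[[? ?] ?] ?].
- eapply continuous_ext; [|apply (continuous_comp _ Rinv _ IHf)].
  + now intros [[[? ?] ?] ?].
  + apply continuous_Rinv; simpl; auto.
- eapply continuous_ext; [|apply (continuous_comp _ sqrt _ IHf)].
  + now intros [[[? ?] ?] ?].
  + apply continuous_sqrt.
Qed.

(** A derivative along an arbitrary fixed direction treats the four partial
    derivatives in a single induction. *)
Lemma elementary_derive W f dx dy du dv : elementary W f ->
  exists g, elementary W g /\ forall x y u v, W x y u v ->
    is_derive (fun s => f (x + s * dx) (y + s * dy) (u + s * du) (v + s * dv)) 0
              (g x y u v).
Proof.
induction 1 as [k| | | | |f g Ef [f' [Ef' Hf]] Eg [g' [Eg' Hg]]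
               |f g Ef [f' [Ef' Hf]] Eg [g' [Eg' Hg]]
               |f Ef [f' [Ef' Hf]] Nf|f Ef [f' [Ef' Hf]] Pf].
1-5: eexists; split; [apply elem_const|].
1-5: intros; auto_derive; [auto|reflexivity || (rewrite Rmult_1_l; reflexivity)].
- exists (fun x y u v => f' x y u v + g' x y u v); split; [now constructor|].
  intros x y u v HW; apply (is_derive_plus (K := R_AbsRing) (V := R_NormedModule)); auto.
- exists (fun x y u v => f' x y u v * g x y u v + f x y u v * g' x y u v); split.
  { repeat constructor; auto. }
  intros x y u v HW.
  specialize (Hf _ _ _ _ HW); specialize (Hg _ _ _ _ HW).
  evar_last; [apply (is_derive_mult _ _ _ _ _ Hf Hg); intros; apply Rmult_comm|].
  unfold plus, mult; simpl; rewrite !Rmult_0_l, !Rplus_0_r; reflexivity.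
- exists (fun x y u v => (-1) * f' x y u v * (/ f x y u v * / f x y u v)); split.
  { repeat constructor; auto. }
  intros x y u v HW; specialize (Hf _ _ _ _ HW); specialize (Nf _ _ _ _ HW).
  evar_last; [apply (is_derive_inv _ _ _ Hf)|]; rewrite !Rmult_0_l, !Rplus_0_r; auto.
  field; auto.
- exists (fun x y u v => f' x y u v * / (2 * sqrt (f x y u v))); split.
  { repeat constructor; auto.
    intros x y u v HW; assert (H := sqrt_lt_R0 _ (Pf _ _ _ _ HW)); lra. }
  intros x y u v HW; specialize (Hf _ _ _ _ HW); specialize (Pf _ _ _ _ HW).
  evar_last; [apply (is_derive_sqrt _ _ _ Hf)|]; rewrite !Rmult_0_l, !Rplus_0_r; auto.
Qed.

Definition open4 (W : R -> R -> R -> R -> Prop) : Prop :=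
  forall x y u v, W x y u v ->
    locally (x, y, u, v) (fun p : R * R * R * R => let '(x', y', u', v') := p in W x' y' u' v').

Lemma open4_lines W x y u v : open4 W -> W x y u v ->
    locally x (fun s => W s y u v) /\ locally y (fun s => W x s u v) /\
    locally u (fun s => W x y s v) /\ locally v (fun s => W x y u s).
Proof.
intros HO HW; destruct (HO _ _ _ _ HW) as [d Hd].
repeat split; exists d; intros s Hs.
- apply (Hd (s, y, u, v)); repeat split; try apply ball_center; exact Hs.
- apply (Hd (x, s, u, v)); repeat split; try apply ball_center; exact Hs.
- apply (Hd (x, y, s, v)); repeat split; try apply ball_center; exact Hs.
- apply (Hd (x, y, u, s)); repeat split; try apply ball_center; exact Hs.
Qed.

Lemma open4_positive f :
  elementary (fun _ _ _ _ => True) f -> open4 (fun x y u v => 0 < f x y u v).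
Proof.
intros Hf x y u v Hp.
assert (H := elementary_continuous _ f x y u v Hf I _ (open_gt 0 _ Hp)).
unfold filtermap in H; revert H.
apply filter_imp; now intros [[[x' y'] u'] v'].
Qed.

Lemma open4_and W W' : open4 W -> open4 W' ->
  open4 (fun x y u v => W x y u v /\ W' x y u v).
Proof.
intros HO HO' x y u v [HW HW'].
generalize (filter_and _ _ (HO _ _ _ _ HW) (HO' _ _ _ _ HW')).
apply filter_imp; now intros [[[x' y'] u'] v'].
Qed.

Lemma is_derive_shift (f : R -> R) (x l : R) :
  is_derive (fun s => f (x + s * 1)) 0 l -> is_derive f x l.
Proof.
intros H.
apply is_derive_ext with (fun s => f (x + (s - x) * 1));
  [intros s; f_equal; ring|].
evar_last.
- apply (is_derive_comp (fun s => f (x + s * 1)) (fun s => s - x)).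
  + replace (x - x) with 0 by ring; exact H.
  + auto_derive; [auto|reflexivity].
- unfold scal; simpl; unfold mult; simpl; ring.
Qed.

Lemma elementary_partials W f : elementary W f ->
  exists fx fy fu fv,
    (elementary W fx /\ elementary W fy /\ elementary W fu /\ elementary W fv) /\
    forall x y u v, W x y u v ->
      is_derive (fun s => f s y u v) x (fx x y u v) /\
      is_derive (fun s => f x s u v) y (fy x y u v) /\
      is_derive (fun s => f x y s v) u (fu x y u v) /\
      is_derive (fun s => f x y u s) v (fv x y u v).
Proof.
intros Hf.
destruct (elementary_derive W f 1 0 0 0 Hf) as [fx [Ex Hx]].
destruct (elementary_derive W f 0 1 0 0 Hf) as [fy [Ey Hy]].
destruct (elementary_derive W f 0 0 1 0 Hf) as [fu [Eu Hu]].
destruct (elementary_derive W f 0 0 0 1 Hf) as [fv [Ev Hv]].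
exists fx, fy, fu, fv; split; [tauto|].
intros x y u v HW; split; [|split; [|split]]; apply is_derive_shift.
- eapply is_derive_ext; [|exact (Hx _ _ _ _ HW)]; 
  intros s; simpl; now rewrite !Rmult_0_r, !Rplus_0_r.
- eapply is_derive_ext; [|exact (Hy _ _ _ _ HW)]; 
  intros s; simpl; now rewrite !Rmult_0_r, !Rplus_0_r.
- eapply is_derive_ext; [|exact (Hu _ _ _ _ HW)]; 
  intros s; simpl; now rewrite !Rmult_0_r, !Rplus_0_r.
- eapply is_derive_ext; [|exact (Hv _ _ _ _ HW)]; 
  intros s; simpl; now rewrite !Rmult_0_r, !Rplus_0_r.
Qed.

(** Agreement with an elementary function is required on [W] only: the partial
    derivatives are total operators and coincide with elementary functions only
    there.  As [W] is open, the values on [W] determine continuity and derivatives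
    on [W]. *)
Lemma elementary_Ck W : open4 W -> forall k f g, elementary W g ->
  (forall x y u v, W x y u v -> f x y u v = g x y u v) -> Ck_on k W f.
Proof.
intros HO; induction k as [|k IH]; intros f g Eg Hfg; (split; [|auto]).
1, 2: intros x y u v HW; unfold continuous4.
1, 2: apply (continuous_ext_loc _
          (fun p => let '(x', y', u', v') := p in g x' y' u' v')).
1, 3: generalize (HO _ _ _ _ HW); apply filter_imp.
1, 2: intros [[[x' y'] u'] v'] HW'; symmetry; auto.
1, 2: now apply (elementary_continuous W).
destruct (elementary_partials W g Eg)
  as (gx & gy & gu & gv & (Ex & Ey & Eu & Ev) & Hg).
assert (Hf : forall x y u v, W x y u v ->
      is_derive (fun s => f s y u v) x (gx x y u v) /\
      is_derive (fun s => f x s u v) y (gy x y u v) /\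
      is_derive (fun s => f x y s v) u (gu x y u v) /\
      is_derive (fun s => f x y u s) v (gv x y u v)).
{ intros x y u v HW.
  destruct (Hg x y u v HW) as (Hx & Hy & Hu & Hv).
  destruct (open4_lines W x y u v HO HW) as (Lx & Ly & Lu & Lv).
  split; [|split; [|split]]; eapply is_derive_ext_loc;
    [|exact Hx| |exact Hy| |exact Hu| |exact Hv].
  - revert Lx; apply filter_imp; intros s Hs; symmetry; auto.
  - revert Ly; apply filter_imp; intros s Hs; symmetry; auto.
  - revert Lu; apply filter_imp; intros s Hs; symmetry; auto.
  - revert Lv; apply filter_imp; intros s Hs; symmetry; auto. }
split; [|split; [|split; [|split]]].
- intros x y u v HW; destruct (Hf x y u v HW) as (Hx & Hy & Hu & Hv).
  split; [|split; [|split]]; eexists; eassumption.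
- apply (IH _ gx Ex); intros x y u v HW; apply is_derive_unique; now apply Hf.
- apply (IH _ gy Ey); intros x y u v HW; apply is_derive_unique; now apply Hf.
- apply (IH _ gu Eu); intros x y u v HW; apply is_derive_unique; now apply Hf.
- apply (IH _ gv Ev); intros x y u v HW; apply is_derive_unique; now apply Hf.
Qed.

(** * The family of Finsler functions *)

Definition slit_disk : R -> R -> R -> R -> Prop := slit_tangent D0.

(** Up to a constant, the hyperbolic metric of the disk is the Euclidean one
    divided by this function. *)
Definition conf (x y : R) : R := 1 - (x ^ 2 + y ^ 2).
Definition speed (u v : R) : R := sqrt (u ^ 2 + v ^ 2).
Definition twisted_speed (e x y u v : R) : R := speed u v + e * (y * u - x * v).
Definition G (e : R) : fun4 := fun x y u v => twisted_speed e x y u v / (2 * conf x y).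

Definition Gx (e x y u v : R) : R :=
  x * twisted_speed e x y u v / conf x y ^ 2 - e * v / (2 * conf x y).
Definition Gy (e x y u v : R) : R :=
  y * twisted_speed e x y u v / conf x y ^ 2 + e * u / (2 * conf x y).
Definition Gu (e x y u v : R) : R := (u / speed u v + e * y) / (2 * conf x y).
Definition Gv (e x y u v : R) : R := (v / speed u v - e * x) / (2 * conf x y).

Lemma square_sum_pos u v : (u, v) <> (0, 0) -> 0 < u ^ 2 + v ^ 2.
Proof.
intros H; destruct (Req_dec u 0) as [Hu|Hu]; [|generalize (pow2_ge_0 v), (pow2_gt_0 u Hu); lra].
destruct (Req_dec v 0) as [Hv|Hv]; [now subst|generalize (pow2_ge_0 u), (pow2_gt_0 v Hv); lra].
Qed.

Lemma slit_tangent_positive x y u v :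
  slit_disk x y u v <-> 0 < conf x y /\ 0 < u ^ 2 + v ^ 2.
Proof.
unfold slit_disk, slit_tangent, D0, conf; split.
- intros [H1 H2]; split; [lra|now apply square_sum_pos].
- intros [H1 H2]; split; [lra|]; intros [= -> ->]; lra.
Qed.

Lemma slit_tangent_open : open4 slit_disk.
Proof.
intros x y u v HW; apply slit_tangent_positive in HW.
generalize (open4_and _ _
  (open4_positive (fun x y u v => 1 + (-1) * (x * x + y * y)) ltac:(repeat constructor))
  (open4_positive (fun x y u v => u * u + v * v) ltac:(repeat constructor))).
intros HO; generalize (HO x y u v ltac:(unfold conf in HW; lra)).
apply filter_imp; intros [[[x' y'] u'] v'] H.
apply slit_tangent_positive; unfold conf; lra.
Qed.

Lemma slit_tangent_lines x y u v : slit_disk x y u v ->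
  locally x (fun s => slit_disk s y u v) /\ locally y (fun s => slit_disk x s u v) /\
  locally u (fun s => slit_disk x y s v) /\ locally v (fun s => slit_disk x y u s).
Proof. exact (open4_lines _ _ _ _ _ slit_tangent_open). Qed.

Lemma speed_pos x y u v : slit_disk x y u v -> 0 < speed u v.
Proof. intros H; apply slit_tangent_positive in H; now apply sqrt_lt_R0. Qed.

Lemma speed_sqr u v : speed u v ^ 2 = u ^ 2 + v ^ 2.
Proof. apply pow2_sqrt; generalize (pow2_ge_0 u), (pow2_ge_0 v); lra. Qed.

(** Cauchy-Schwarz: the linear part is at most [speed u v] times the distance
    from the origin, which is less than 1. *)
Lemma twisted_speed_pos e x y u v : e * e = 1 -> slit_disk x y u v -> 0 < twisted_speed e x y u v.
Proof.
intros He HW; assert (Hr := speed_pos _ _ _ _ HW); unfold twisted_speed.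
apply slit_tangent_positive in HW; destruct HW as [HD Hs]; unfold conf in HD.
assert (H2 := speed_sqr u v).
apply Rnot_le_lt; intros Hn.
assert (Hcs : (y * u - x * v) ^ 2 <= (x ^ 2 + y ^ 2) * (u ^ 2 + v ^ 2)).
{ generalize (pow2_ge_0 (x * u + y * v)); nra. }
assert (speed u v ^ 2 <= (y * u - x * v) ^ 2).
{ replace ((y * u - x * v) ^ 2) with ((- (e * (y * u - x * v))) ^ 2).
  - apply pow_incr; lra.
  - transitivity (e * e * (y * u - x * v) ^ 2); [ring|rewrite He; ring]. }
nra.
Qed.

Lemma G_elementary e : elementary slit_disk (G e).
Proof.
change (elementary slit_disk (fun x y u v =>
  (sqrt (u * (u * 1) + v * (v * 1)) + e * (y * u + - (x * v))) *
  / (2 * (1 + - (x * (x * 1) + y * (y * 1)))))).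
assert (Hopp : forall f, elementary slit_disk f -> elementary slit_disk (fun x y u v => - f x y u v)).
{ intros f Hf.
  replace (fun x y u v => - f x y u v) with (fun x y u v => (-1) * f x y u v).
  - now repeat constructor.
  - do 4 (apply functional_extensionality; intros ?); ring. }
apply elem_mult; [apply elem_plus|apply elem_inv].
- apply (elem_sqrt _ (fun x y u v => u * (u * 1) + v * (v * 1)));
    [repeat constructor|].
  intros x y u v HW; apply slit_tangent_positive in HW; lra.
- apply elem_mult; [constructor|]; apply elem_plus; [repeat constructor|].
  apply (Hopp (fun x y u v => x * v)); repeat constructor.
- apply elem_mult; [constructor|]; apply elem_plus; [constructor|].
  apply (Hopp (fun x y u v => x * (x * 1) + y * (y * 1))); repeat constructor.
- intros x y u v HW; apply slit_tangent_positive in HW; unfold conf in HW; lra.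
Qed.

Lemma G_smooth e : smooth_on slit_disk (G e).
Proof. intros k; now apply (elementary_Ck _ slit_tangent_open k _ (G e) (G_elementary e)). Qed.

Lemma speed_derive_l u v : 0 < u ^ 2 + v ^ 2 ->
  is_derive (fun s : R => speed s v) u (u / speed u v).
Proof.
intros H; assert (Hs := sqrt_lt_R0 _ H); unfold speed; auto_derive.
- simpl in *; lra.
- change (u * (u * 1)) with (u ^ 2); change (v * (v * 1)) with (v ^ 2); field; lra.
Qed.

Lemma speed_derive_r u v : 0 < u ^ 2 + v ^ 2 ->
  is_derive (fun s : R => speed u s) v (v / speed u v).
Proof.
intros H; assert (Hs := sqrt_lt_R0 _ H); unfold speed; auto_derive.
- simpl in *; lra.
- change (u * (u * 1)) with (u ^ 2); change (v * (v * 1)) with (v ^ 2); field; lra.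
Qed.

Lemma G_partials e x y u v : slit_disk x y u v ->
  is_derive (fun s : R => G e s y u v) x (Gx e x y u v) /\
  is_derive (fun s : R => G e x s u v) y (Gy e x y u v) /\
  is_derive (fun s : R => G e x y s v) u (Gu e x y u v) /\
  is_derive (fun s : R => G e x y u s) v (Gv e x y u v).
Proof.
intros HW; assert (Hr := speed_pos _ _ _ _ HW).
apply slit_tangent_positive in HW; destruct HW as [HD Hs].
unfold G, Gx, Gy, Gu, Gv, twisted_speed; unfold conf in *; split; [|split; [|split]].
- auto_derive; [simpl in *; lra|]; field; lra.
- auto_derive; [simpl in *; lra|]; field; lra.
- assert (H := speed_derive_l u v Hs); assert (E := is_derive_unique _ _ _ H).
  auto_derive; [now exists (u / speed u v)|].
  rewrite E; field; lra.
- assert (H := speed_derive_r u v Hs); assert (E := is_derive_unique _ _ _ H).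
  auto_derive; [now exists (v / speed u v)|].
  rewrite E; field; lra.
Qed.

Lemma dX_G e x y u v : slit_disk x y u v -> dX (G e) x y u v = Gx e x y u v.
Proof. intros HW; apply is_derive_unique; now apply G_partials. Qed.
Lemma dY_G e x y u v : slit_disk x y u v -> dY (G e) x y u v = Gy e x y u v.
Proof. intros HW; apply is_derive_unique; now apply G_partials. Qed.
Lemma dU_G e x y u v : slit_disk x y u v -> dU (G e) x y u v = Gu e x y u v.
Proof. intros HW; apply is_derive_unique; now apply G_partials. Qed.
Lemma dV_G e x y u v : slit_disk x y u v -> dV (G e) x y u v = Gv e x y u v.
Proof. intros HW; apply is_derive_unique; now apply G_partials. Qed.

(** Only the norm contributes to the second fibre derivatives of [G e]; the
    factor [k] is [G e] times the coefficient of that contribution. *)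
Lemma fibre_hessian e x y u v : slit_disk x y u v ->
  let E : fun4 := fun x y u v => (G e x y u v) ^ 2 / 2 in
  let k := G e x y u v / (2 * conf x y * speed u v ^ 3) in
  dU (dU E) x y u v = Gu e x y u v ^ 2 + k * v ^ 2 /\
  dU (dV E) x y u v = Gu e x y u v * Gv e x y u v - k * (u * v) /\
  dV (dU E) x y u v = Gu e x y u v * Gv e x y u v - k * (u * v) /\
  dV (dV E) x y u v = Gv e x y u v ^ 2 + k * u ^ 2.
Proof.
intros HW E k.
assert (EU : forall u v, slit_disk x y u v -> dU E x y u v = G e x y u v * Gu e x y u v).
{ intros u' v' HW'; apply is_derive_unique; unfold E.
  destruct (G_partials e x y u' v' HW') as (_ & _ & H & _).
  evar_last; [auto_derive; [eexists; eassumption|reflexivity]|].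
  rewrite (is_derive_unique _ _ _ H); field. }
assert (EV : forall u v, slit_disk x y u v -> dV E x y u v = G e x y u v * Gv e x y u v).
{ intros u' v' HW'; apply is_derive_unique; unfold E.
  destruct (G_partials e x y u' v' HW') as (_ & _ & _ & H).
  evar_last; [auto_derive; [eexists; eassumption|reflexivity]|].
  rewrite (is_derive_unique _ _ _ H); field. }
destruct (slit_tangent_lines x y u v HW) as (_ & _ & Lu & Lv).
destruct (G_partials e x y u v HW) as (_ & _ & HU & HV).
assert (Hr := speed_pos _ _ _ _ HW).
assert (Hq := speed_sqr u v).
assert (HD := HW); apply slit_tangent_positive in HD; destruct HD as [HD Hs].
assert (Su := speed_derive_l u v Hs); assert (Sv := speed_derive_r u v Hs).
assert (GUu : is_derive (fun s : R => Gu e x y s v) u (v ^ 2 / (2 * conf x y * speed u v ^ 3))).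
{ unfold Gu; evar_last.
  - auto_derive; [|reflexivity]; repeat split; [eexists; eassumption|lra].
  - rewrite (is_derive_unique _ _ _ Su).
    replace (v ^ 2) with (speed u v ^ 2 - u ^ 2) by lra; field; lra. }
assert (GUv : is_derive (fun s : R => Gu e x y u s) v (- (u * v) / (2 * conf x y * speed u v ^ 3))).
{ unfold Gu; evar_last.
  - auto_derive; [|reflexivity]; repeat split; [eexists; eassumption|lra].
  - rewrite (is_derive_unique _ _ _ Sv); field; lra. }
assert (GVu : is_derive (fun s : R => Gv e x y s v) u (- (u * v) / (2 * conf x y * speed u v ^ 3))).
{ unfold Gv; evar_last.
  - auto_derive; [|reflexivity]; repeat split; [eexists; eassumption|lra].
  - rewrite (is_derive_unique _ _ _ Su); field; lra. }
assert (GVv : is_derive (fun s : R => Gv e x y u s) v (u ^ 2 / (2 * conf x y * speed u v ^ 3))).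
{ unfold Gv; evar_last.
  - auto_derive; [|reflexivity]; repeat split; [eexists; eassumption|lra].
  - rewrite (is_derive_unique _ _ _ Sv).
    replace (u ^ 2) with (speed u v ^ 2 - v ^ 2) by lra; field; lra. }
split; [|split; [|split]]; apply is_derive_unique.
- apply is_derive_ext_loc with (fun s : R => G e x y s v * Gu e x y s v).
  { revert Lu; apply filter_imp; intros s Hs'; symmetry; auto. }
  evar_last; [auto_derive; [|reflexivity]; repeat split; eexists; eassumption|].
  rewrite (is_derive_unique _ _ _ HU), (is_derive_unique _ _ _ GUu).
  unfold k; field; lra.
- apply is_derive_ext_loc with (fun s : R => G e x y s v * Gv e x y s v).
  { revert Lu; apply filter_imp; intros s Hs'; symmetry; auto. }
  evar_last; [auto_derive; [|reflexivity]; repeat split; eexists; eassumption|].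
  rewrite (is_derive_unique _ _ _ HU), (is_derive_unique _ _ _ GVu).
  unfold k; field; lra.
- apply is_derive_ext_loc with (fun s : R => G e x y u s * Gu e x y u s).
  { revert Lv; apply filter_imp; intros s Hs'; symmetry; auto. }
  evar_last; [auto_derive; [|reflexivity]; repeat split; eexists; eassumption|].
  rewrite (is_derive_unique _ _ _ HV), (is_derive_unique _ _ _ GUv).
  unfold k; field; lra.
- apply is_derive_ext_loc with (fun s : R => G e x y u s * Gv e x y u s).
  { revert Lv; apply filter_imp; intros s Hs'; symmetry; auto. }
  evar_last; [auto_derive; [|reflexivity]; repeat split; eexists; eassumption|].
  rewrite (is_derive_unique _ _ _ HV), (is_derive_unique _ _ _ GVv).
  unfold k; field; lra.
Qed.

(** The quadratic form is
    [(Gu a + Gv b)^2 + k (v a - u b)^2] with [k > 0].  If the second square is zero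
    then [(a, b)] is a non-zero multiple of [(u, v)], and by Euler's identity
    [u Gu + v Gv = G] the first one is not. *)
Lemma G_strongly_convex e x y u v : e * e = 1 -> slit_disk x y u v ->
  strongly_convex_at (G e) x y u v.
Proof.
unfold strongly_convex_at; intros He HW a b Hab.
destruct (fibre_hessian e x y u v HW) as (-> & -> & -> & ->).
assert (Hr := speed_pos _ _ _ _ HW).
assert (Hn := twisted_speed_pos e x y u v He HW).
assert (HD := HW); apply slit_tangent_positive in HD; destruct HD as [HD Hs].
assert (HG : 0 < G e x y u v) by (apply Rdiv_lt_0_compat; lra).
assert (Hk : 0 < G e x y u v / (2 * conf x y * speed u v ^ 3)).
{ apply Rdiv_lt_0_compat; [easy|].
  apply Rmult_lt_0_compat; [lra|now apply pow_lt]. }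
set (k := G e x y u v / _) in *.
match goal with |- 0 < ?l => replace l with
  ((Gu e x y u v * a + Gv e x y u v * b) ^ 2 + k * (v * a - u * b) ^ 2) by ring end.
destruct (Req_dec (v * a - u * b) 0) as [H0|H0].
2: { generalize (pow2_ge_0 (Gu e x y u v * a + Gv e x y u v * b)),
       (Rmult_lt_0_compat _ _ Hk (pow2_gt_0 _ H0)); lra. }
assert (Hl : (u ^ 2 + v ^ 2) * (Gu e x y u v * a + Gv e x y u v * b)
             = (u * a + v * b) * G e x y u v).
{ transitivity ((u * a + v * b) * (u * Gu e x y u v + v * Gv e x y u v)
      + (v * a - u * b) * (v * Gu e x y u v - u * Gv e x y u v)); [ring|].
  rewrite H0; unfold G, Gu, Gv, twisted_speed.
  replace (speed u v + e * (y * u - x * v))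
    with (speed u v ^ 2 / speed u v + e * (y * u - x * v)) by (field; lra).
  rewrite speed_sqr; field; lra. }
assert (H1 : u * a + v * b <> 0).
{ intros H1; generalize (square_sum_pos a b Hab).
  assert ((u ^ 2 + v ^ 2) * (a ^ 2 + b ^ 2) = 0); [|nra].
  transitivity ((u * a + v * b) ^ 2 + (v * a - u * b) ^ 2); [ring|].
  rewrite H0, H1; ring. }
assert (H2 : Gu e x y u v * a + Gv e x y u v * b <> 0).
{ intros H2; rewrite H2, Rmult_0_r in Hl; symmetry in Hl.
  apply Rmult_integral in Hl; lra. }
rewrite H0; generalize (pow2_gt_0 _ H2); lra.
Qed.

Lemma G_finsler e : e * e = 1 -> finsler D0 (G e).
Proof.
intros He; split; [apply G_smooth|]; split; [|split].
- intros x y u v l _ Hl; unfold G, twisted_speed.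
  replace (speed (l * u) (l * v)) with (l * speed u v); [unfold Rdiv; ring|].
  unfold speed; replace ((l * u) ^ 2 + (l * v) ^ 2) with (l ^ 2 * (u ^ 2 + v ^ 2)) by ring.
  rewrite sqrt_mult_alt, sqrt_pow2; try lra; apply pow2_ge_0.
- intros x y u v HW; assert (Hn := twisted_speed_pos e x y u v He HW).
  apply slit_tangent_positive in HW; apply Rdiv_lt_0_compat; lra.
- intros x y u v; now apply G_strongly_convex.
Qed.

(** * The Euler-Lagrange equations as one scalar equation *)

Definition ddx (c : curve) (t : R) : R := Derive (Derive (cx c)) t.
Definition ddy (c : curve) (t : R) : R := Derive (Derive (cy c)) t.

Lemma dom_locally c t : dom c t -> locally t (dom c).
Proof.
intros [H1 H2]; apply (locally_interval _ t (lo c) (hi c) H1 H2).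
now split.
Qed.

Lemma curve_slit c t : regular_curve D0 c -> dom c t ->
  slit_disk (cx c t) (cy c t) (Derive (cx c) t) (Derive (cy c) t).
Proof. intros (_ & _ & _ & H1 & H2) Ht; split; auto. Qed.

Lemma curve_derive c t : regular_curve D0 c -> dom c t ->
  is_derive (cx c) t (Derive (cx c) t) /\ is_derive (cy c) t (Derive (cy c) t) /\
  is_derive (Derive (cx c)) t (ddx c t) /\ is_derive (Derive (cy c)) t (ddy c t).
Proof.
intros (_ & Hx & Hy & _) Ht; split; [|split; [|split]]; apply Derive_correct.
- exact (Hx 1%nat t Ht).
- exact (Hy 1%nat t Ht).
- exact (Hx 2%nat t Ht).
- exact (Hy 2%nat t Ht).
Qed.

(** The left side is [conf * speed^2] times the rate at which the velocity turns,
    so the equation prescribes the signed curvature of the curve. *)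
Definition geodesic_eq (e : R) (c : curve) (t : R) : Prop :=
  (Derive (cx c) t * ddy c t - Derive (cy c) t * ddx c t) * conf (cx c t) (cy c t)
  = 2 * e * speed (Derive (cx c) t) (Derive (cy c) t) ^ 2 * along (twisted_speed e) c t.

Lemma speed_derive (f g : R -> R) t f' g' : 0 < f t ^ 2 + g t ^ 2 ->
  is_derive f t f' -> is_derive g t g' ->
  is_derive (fun s => speed (f s) (g s)) t ((f t * f' + g t * g') / speed (f t) (g t)).
Proof.
intros H Hf Hg; assert (Hs := sqrt_lt_R0 _ H).
unfold speed; evar_last; [auto_derive; [|reflexivity]|].
- repeat split; [eexists; eassumption|eexists; eassumption|simpl in *; lra].
- replace (Derive (fun x => f x) t) with f' by (symmetry; now apply is_derive_unique).
  replace (Derive (fun x => g x) t) with g' by (symmetry; now apply is_derive_unique).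
  change (f t * (f t * 1)) with (f t ^ 2); change (g t * (g t * 1)) with (g t ^ 2).
  field; lra.
Qed.

(** The goals left by [auto_derive] mention derivatives of eta-expanded
    functions, which plain rewriting with the hypotheses does not find. *)
Ltac replace_derivatives :=
  repeat match goal with
  | H : is_derive ?f ?t ?l |- context [Derive (fun x => ?f x) ?t] =>
      progress (replace (Derive (fun x => f x) t) with l
        by (symmetry; apply is_derive_unique; exact H))
  end.

(** Both momenta have this form, with [U] a velocity component, [S] the speed and
    [Z] the other coordinate. *)
Lemma covector_derive (X Y Z U S : R -> R) (k t x' y' z' u' s' : R) :
  is_derive X t x' -> is_derive Y t y' -> is_derive Z t z' ->
  is_derive U t u' -> is_derive S t s' -> S t <> 0 -> conf (X t) (Y t) <> 0 ->
  is_derive (fun s => (U s / S s + k * Z s) / (2 * conf (X s) (Y s))) t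
    (((u' * S t - U t * s') / S t ^ 2 + k * z') / (2 * conf (X t) (Y t))
     + (U t / S t + k * Z t) * (X t * x' + Y t * y') / conf (X t) (Y t) ^ 2).
Proof.
intros DX DY DZ DU DS HS HD; unfold conf in *.
evar_last; [auto_derive; [|reflexivity]|].
- repeat split; try (eexists; eassumption); simpl in *; lra.
- replace_derivatives; field; auto.
Qed.

Lemma momentum_identity e x y u v u' v' r : e * e = 1 -> 0 < r ->
  r ^ 2 = u ^ 2 + v ^ 2 -> 0 < conf x y ->
  ((u' * r - u * ((u * u' + v * v') / r)) / r ^ 2 + e * v) / (2 * conf x y)
  + (u / r + e * y) * (x * u + y * v) / conf x y ^ 2
  = x * (r + e * (y * u - x * v)) / conf x y ^ 2 - e * v / (2 * conf x y)
    - v / r * ((u * v' - v * u') / (2 * r ^ 2 * conf x y)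
               - e * (r + e * (y * u - x * v)) / conf x y ^ 2).
Proof.
unfold conf; intros He Hr Hq HD; field_simplify_eq; [|lra].
apply Rminus_diag_uniq.
transitivity ((r ^ 2 - (u ^ 2 + v ^ 2)) * (u' * (1 - x ^ 2 - y ^ 2) - 2 * r ^ 2 * x)
              + (e * e - 1) * (2 * r ^ 2 * v * (x * v - y * u))).
- ring.
- rewrite Hq, He; ring.
Qed.

(** Both Euler-Lagrange defects are multiples of the same [z], by the components
    of the unit normal: homogeneity makes the defect vanish in the tangent
    direction. *)
Lemma momentum_derive e c t : e * e = 1 -> regular_curve D0 c -> dom c t ->
  let u := Derive (cx c) t in let v := Derive (cy c) t in
  let z := (u * ddy c t - v * ddx c t) / (2 * speed u v ^ 2 * conf (cx c t) (cy c t))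
           - e * along (twisted_speed e) c t / conf (cx c t) (cy c t) ^ 2 in
  is_derive (along (Gu e) c) t (along (Gx e) c t - v / speed u v * z) /\
  is_derive (along (Gv e) c) t (along (Gy e) c t + u / speed u v * z).
Proof.
intros He Hc Ht u v z.
assert (HW := curve_slit c t Hc Ht).
destruct (curve_derive c t Hc Ht) as (Dx & Dy & Du & Dv).
assert (Hr := speed_pos _ _ _ _ HW); assert (Hq := speed_sqr u v).
apply slit_tangent_positive in HW; destruct HW as [HD Hs].
assert (Hsp := speed_derive _ _ t _ _ Hs Du Dv).
fold u v in Hr, Hs, Hsp, Dx, Dy.
unfold z, along, Gu, Gv, Gx, Gy, twisted_speed; clear z; split.
- evar_last.
  + apply (covector_derive (cx c) (cy c) (cy c) (Derive (cx c)) _ e t _ _ _ _ _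
             Dx Dy Dy Du Hsp); fold u v; lra.
  + now apply momentum_identity.
- apply is_derive_ext with (fun s =>
      (Derive (cy c) s / speed (Derive (cx c) s) (Derive (cy c) s) + - e * cx c s)
      / (2 * conf (cx c s) (cy c s))).
  { intros s; f_equal; simpl; ring. }
  evar_last.
  + apply (covector_derive (cx c) (cy c) (cx c) (Derive (cy c)) _ (- e) t _ _ _ _ _
             Dx Dy Dx Dv Hsp); fold u v; lra.
  + fold u v.
    (* The reflection in the diagonal exchanges the two momenta and turns [e] into [- e]. *)
    generalize (momentum_identity (- e) (cy c t) (cx c t) v u (ddy c t) (ddx c t) (speed u v)).
    replace (conf (cy c t) (cx c t)) with (conf (cx c t) (cy c t)) by (unfold conf; ring).
    intros H.
    match type of H with _ -> _ -> _ -> _ -> ?l = ?r =>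
      match goal with |- ?l' = ?r' =>
        replace l' with l; [replace r' with r; [apply H; lra|]|] end end.
    * field; lra.
    * replace (v * ddy c t + u * ddx c t) with (u * ddx c t + v * ddy c t) by ring.
      field; lra.
Qed.

(** The common factor [z] of the two defects is zero as soon as both
    defects are, because the unit normal has a non-zero component. *)
Lemma geodesic_eq_iff e c : e * e = 1 -> regular_curve D0 c ->
  euler_lagrange (G e) c <-> forall t, dom c t -> geodesic_eq e c t.
Proof.
intros He Hc.
assert (Hdom : forall t, dom c t ->
  ((is_derive (along (dU (G e)) c) t (along (dX (G e)) c t) /\
    is_derive (along (dV (G e)) c) t (along (dY (G e)) c t)) <-> geodesic_eq e c t)).
{ intros t Ht.
  destruct (momentum_derive e c t He Hc Ht) as [HU HV].
  assert (HW := curve_slit c t Hc Ht).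
  assert (Hr := speed_pos _ _ _ _ HW).
  assert (Hd := HW); apply slit_tangent_positive in Hd; destruct Hd as [HD Hs].
  assert (LU : locally t (fun s => along (Gu e) c s = along (dU (G e)) c s)).
  { generalize (dom_locally c t Ht); apply filter_imp; intros s Hs'.
    symmetry; now apply dU_G, curve_slit. }
  assert (LV : locally t (fun s => along (Gv e) c s = along (dV (G e)) c s)).
  { generalize (dom_locally c t Ht); apply filter_imp; intros s Hs'.
    symmetry; now apply dV_G, curve_slit. }
  apply (is_derive_ext_loc _ _ _ _ LU) in HU.
  apply (is_derive_ext_loc _ _ _ _ LV) in HV.
  replace (along (dX (G e)) c t) with (along (Gx e) c t)
    by (symmetry; now apply dX_G).
  replace (along (dY (G e)) c t) with (along (Gy e) c t)
    by (symmetry; now apply dY_G).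
  set (u := Derive (cx c) t) in *; set (v := Derive (cy c) t) in *.
  set (z := (u * ddy c t - v * ddx c t) / _ - _) in *.
  assert (Hz : geodesic_eq e c t <-> z = 0).
  { unfold geodesic_eq; fold u v.
    replace z with (((u * ddy c t - v * ddx c t) * conf (cx c t) (cy c t)
       - 2 * e * speed u v ^ 2 * along (twisted_speed e) c t)
       / (2 * speed u v ^ 2 * conf (cx c t) (cy c t) ^ 2)) by (unfold z; field; lra).
    split; intros H.
    - rewrite H; unfold Rdiv; ring.
    - apply Rmult_integral in H; destruct H as [H|H]; [lra|].
      exfalso; revert H; apply Rinv_neq_0_compat, Rgt_not_eq.
      apply Rmult_lt_0_compat; [|now apply pow_lt].
      apply Rmult_lt_0_compat; [lra|now apply pow_lt]. }
  rewrite Hz; split.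
  - intros [H1 H2].
    assert (E1 := eq_trans (eq_sym (is_derive_unique _ _ _ H1)) (is_derive_unique _ _ _ HU)).
    assert (E2 := eq_trans (eq_sym (is_derive_unique _ _ _ H2)) (is_derive_unique _ _ _ HV)).
    assert (K1 : v / speed u v * z = 0) by lra.
    assert (K2 : u / speed u v * z = 0) by lra.
    assert (K : z * (u ^ 2 + v ^ 2) = 0).
    { transitivity (speed u v * (u * (u / speed u v * z) + v * (v / speed u v * z)));
        [field; lra|rewrite K1, K2; ring]. }
    apply Rmult_integral in K; lra.
  - intros H0; rewrite H0, Rmult_0_r in HU, HV.
    rewrite Rminus_0_r in HU; rewrite Rplus_0_r in HV; now split. }
split; intros H t Ht; now apply Hdom; auto.
Qed.

(** * Geodesics lie on horocycles *)

Lemma dom_between c a b t : dom c a -> dom c b -> a <= t <= b -> dom c t.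
Proof.
intros [Ha _] [_ Hb] [H1 H2]; split.
- now apply (Rbar_lt_le_trans _ a).
- now apply (Rbar_le_lt_trans _ b).
Qed.

Lemma dom_nonempty c : Rbar_lt (lo c) (hi c) -> exists t, dom c t.
Proof.
unfold dom; destruct (lo c) as [a| |], (hi c) as [b| |]; simpl; try tauto; intros H.
- exists ((a + b) / 2); lra.
- exists (a + 1); lra.
- exists (b - 1); lra.
- now exists 0.
Qed.

Lemma constant_on_dom c (f : R -> R) : (forall t, dom c t -> is_derive f t 0) ->
  forall a b, dom c a -> dom c b -> f a = f b.
Proof.
intros Hf a b Ha Hb; destruct (Rtotal_order a b) as [H|[->|H]]; [|easy|symmetry].
- apply (eq_is_derive f); [|easy]; intros t Ht; apply Hf; exact (dom_between c a b t Ha Hb Ht).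
- apply (eq_is_derive f); [|easy]; intros t Ht; apply Hf; exact (dom_between c b a t Hb Ha Ht).
Qed.

(** [osc_p], [osc_q] and [osc_r] are the centre and radius of the circle that is
    tangent to [(u, v)] at [(x, y)], turns in the sense of [e] and touches the unit
    circle from inside.  With [T] the unit tangent, the condition that the centre has
    norm [1 - r] gives [r = D / (2 (1 + e (y T1 - x T2)))]; the scale is this radius
    divided by the speed. *)
Definition osc_scale (e x y u v : R) : R := conf x y / (2 * twisted_speed e x y u v).
Definition osc_p (e x y u v : R) : R := x - e * osc_scale e x y u v * v.
Definition osc_q (e x y u v : R) : R := y + e * osc_scale e x y u v * u.
Definition osc_r (e x y u v : R) : R := osc_scale e x y u v * speed u v.

(** The left side is the derivative of [osc_scale] along a curve, as the quotient
    rule produces it; the geodesic equation turns it into minus the scale times the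
    logarithmic derivative of the speed. *)
Lemma osc_scale_identity e x y u v u' v' r : e * e = 1 -> 0 < r ->
  r ^ 2 = u ^ 2 + v ^ 2 -> r + e * (y * u - x * v) <> 0 ->
  (u * v' - v * u') * conf x y = 2 * e * r ^ 2 * (r + e * (y * u - x * v)) ->
  - (x * u + y * v) / (r + e * (y * u - x * v))
  - conf x y * ((u * u' + v * v') / r + e * (y * u' - x * v'))
    / (2 * (r + e * (y * u - x * v)) ^ 2)
  = - (conf x y / (2 * (r + e * (y * u - x * v)))) * (u * u' + v * v') / r ^ 2.
Proof.
intros He Hr Hq HS Hg; apply Rminus_diag_uniq.
transitivity ((e * (x * u + y * v) * ((u * v' - v * u') * conf x y
                 - 2 * e * r ^ 2 * (r + e * (y * u - x * v)))
      + 2 * (x * u + y * v) * r ^ 2 * (r + e * (y * u - x * v)) * (e * e - 1)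
      - conf x y * e * (y * u' - x * v') * (r ^ 2 - (u ^ 2 + v ^ 2)))
    / (2 * (r + e * (y * u - x * v)) ^ 2 * r ^ 2)).
- field; split; [lra|exact HS].
- rewrite Hg, He, Hq; unfold Rdiv; ring.
Qed.

(** The geodesic equation is exactly the constancy of the osculating horocycle.
    The derivative of the scale makes the radius [osc_scale * speed] constant; the
    velocity of the centre is the sum of [(u, v)] and the derivative of
    [e m (- v, u)], with [m] the scale, and these cancel because
    [m J = e speed^2]. *)
Lemma osculating_derive e c t : e * e = 1 -> regular_curve D0 c -> dom c t ->
  geodesic_eq e c t ->
  is_derive (along (osc_p e) c) t 0 /\ is_derive (along (osc_q e) c) t 0 /\
  is_derive (along (osc_r e) c) t 0.
Proof.
intros He Hc Ht Hg.
assert (HW := curve_slit c t Hc Ht).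
destruct (curve_derive c t Hc Ht) as (Dx & Dy & Du & Dv).
assert (Hr := speed_pos _ _ _ _ HW).
assert (Hn := twisted_speed_pos e _ _ _ _ He HW).
assert (HD := HW); apply slit_tangent_positive in HD; destruct HD as [HD Hs].
assert (Hq := speed_sqr (Derive (cx c) t) (Derive (cy c) t)).
unfold geodesic_eq, along in Hg.
set (r := fun s => speed (Derive (cx c) s) (Derive (cy c) s)).
pose proof (speed_derive _ _ t _ _ Hs Du Dv : is_derive r t _) as Dr.
assert (Dm : is_derive (along (osc_scale e) c) t
  (- along (osc_scale e) c t
    * (Derive (cx c) t * ddx c t + Derive (cy c) t * ddy c t) / r t ^ 2)).
{ change (is_derive (fun s => (1 - (cx c s ^ 2 + cy c s ^ 2)) / (2 *
    (r s + e * (cy c s * Derive (cx c) s - cx c s * Derive (cy c) s)))) t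
  (- along (osc_scale e) c t
    * (Derive (cx c) t * ddx c t + Derive (cy c) t * ddy c t) / r t ^ 2)).
  evar_last; [auto_derive; [|reflexivity]|].
  - repeat split; try (eexists; eassumption).
    unfold twisted_speed, r in *; simpl in *; lra.
  - replace_derivatives.
    unfold along, osc_scale, twisted_speed, r in *.
    rewrite <- (osc_scale_identity e _ _ _ _ _ _ _ He Hr Hq); [|lra|exact Hg].
    unfold conf; field; split; lra. }
set (u := Derive (cx c) t) in *; set (v := Derive (cy c) t) in *.
set (m := along (osc_scale e) c) in *.
assert (Er : r t = speed u v) by easy.
assert (Em : m t = conf (cx c t) (cy c t) / (2 * twisted_speed e (cx c t) (cy c t) u v)) by easy.
assert (Hm : m t * (u * ddy c t - v * ddx c t) = e * r t ^ 2).
{ rewrite Em, Er.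
  transitivity ((u * ddy c t - v * ddx c t) * conf (cx c t) (cy c t)
     / (2 * twisted_speed e (cx c t) (cy c t) u v)); [field; lra|].
  rewrite Hg; field; lra. }
split; [|split].
- change (is_derive (fun s => cx c s - e * m s * Derive (cy c) s) t 0).
  evar_last; [auto_derive; [|reflexivity]|].
  + repeat split; eexists; eassumption.
  + replace_derivatives.
    transitivity (u - e * (m t * (u * ddy c t - v * ddx c t)) * u / r t ^ 2
                  - e * m t * ddy c t * (r t ^ 2 - (u ^ 2 + v ^ 2)) / r t ^ 2).
    * fold u v; field; lra.
    * rewrite Hm, Er, Hq; field_simplify_eq; [|rewrite <- Hq; lra].
      replace (e ^ 2) with 1 by lra; ring.
- change (is_derive (fun s => cy c s + e * m s * Derive (cx c) s) t 0).
  evar_last; [auto_derive; [|reflexivity]|].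
  + repeat split; eexists; eassumption.
  + replace_derivatives.
    transitivity (v - e * (m t * (u * ddy c t - v * ddx c t)) * v / r t ^ 2
                  + e * m t * ddx c t * (r t ^ 2 - (u ^ 2 + v ^ 2)) / r t ^ 2).
    * fold u v; field; lra.
    * rewrite Hm, Er, Hq; field_simplify_eq; [|rewrite <- Hq; lra].
      replace (e ^ 2) with 1 by lra; ring.
- change (is_derive (fun s => m s * r s) t 0).
  evar_last; [auto_derive; [|reflexivity]|].
  + repeat split; eexists; eassumption.
  + replace_derivatives. fold u v; rewrite <- Er; field; lra.
Qed.

(** The radius is less than 1 because [1 - r] has the sign of
    [|c + e N|^2], where [c] is the point, of norm less than 1, and [N] the unit
    normal. *)
Lemma osculating_circle e x y u v : e * e = 1 -> slit_disk x y u v ->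
  let p := osc_p e x y u v in let q := osc_q e x y u v in let r := osc_r e x y u v in
  0 < r < 1 /\ p ^ 2 + q ^ 2 = (1 - r) ^ 2 /\ on_circle p q r x y /\
  0 < e * ((x - p) * v - (y - q) * u).
Proof.
intros He HW p q r.
assert (Hs := speed_pos _ _ _ _ HW); assert (Hn := twisted_speed_pos e _ _ _ _ He HW).
assert (Hq := speed_sqr u v).
apply slit_tangent_positive in HW; destruct HW as [HD Hw].
assert (Hm : 0 < osc_scale e x y u v) by (apply Rdiv_lt_0_compat; lra).
assert (Hmn : 2 * osc_scale e x y u v * twisted_speed e x y u v = conf x y)
  by (unfold osc_scale; field; lra).
unfold p, q, r, osc_p, osc_q, osc_r, on_circle in *; clear p q r.
set (m := osc_scale e x y u v) in *; clearbody m.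
unfold twisted_speed, conf in *; set (s := speed u v) in *; clearbody s.
split; [split|split; [|split]].
- now apply Rmult_lt_0_compat.
-
  (* The sum is [s^2 |c + e N|^2], with [N = (- v, u) / s]. *)
  assert (K : 0 < (s * x - e * v) ^ 2 + (s * y + e * u) ^ 2).
  { apply square_sum_pos; intros [= K1 K2].
    assert (K : (s * x) ^ 2 + (s * y) ^ 2 = e * e * s ^ 2).
    { replace (s * x) with (e * v) by lra; replace (s * y) with (- (e * u)) by lra.
      rewrite Hq; ring. }
    rewrite He in K.
    assert (0 < s ^ 2 * (1 - (x ^ 2 + y ^ 2))); [|lra].
    apply Rmult_lt_0_compat; [now apply pow_lt|lra]. }
  assert (K' : s * (2 * (s + e * (y * u - x * v)) - (1 - (x ^ 2 + y ^ 2)) * s)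
               = (s * x - e * v) ^ 2 + (s * y + e * u) ^ 2).
  { transitivity (s ^ 2 * (1 + x ^ 2 + y ^ 2) + 2 * e * s * (y * u - x * v)); [ring|].
    transitivity (s ^ 2 * (x ^ 2 + y ^ 2) + 2 * e * s * (y * u - x * v)
                  + e * e * (u ^ 2 + v ^ 2)); [|ring].
    rewrite He, Hq; ring. }
  rewrite <- K' in K.
  assert (L : 0 < 2 * (s + e * (y * u - x * v)) - (1 - (x ^ 2 + y ^ 2)) * s).
  { apply (Rmult_lt_reg_l s); lra. }
  rewrite <- Hmn in L.
  assert (L' : 0 < 2 * (s + e * (y * u - x * v)) * (1 - m * s)) by lra.
  apply Rnot_le_lt; intros H.
  assert (2 * (s + e * (y * u - x * v)) * (1 - m * s) <= 0); [|lra].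
  rewrite <- (Rmult_0_r (2 * (s + e * (y * u - x * v)))).
  apply Rmult_le_compat_l; lra.
- apply Rminus_diag_uniq.
  transitivity (2 * m * (s + e * (y * u - x * v)) - (1 - (x ^ 2 + y ^ 2))
     + m ^ 2 * (e * e * (u ^ 2 + v ^ 2) - s ^ 2)); [ring|].
  rewrite Hmn, He, Hq; ring.
- transitivity (e * e * (u ^ 2 + v ^ 2) * m ^ 2); [ring|].
  rewrite He, <- Hq; ring.
- replace (e * _) with (e * e * m * (u ^ 2 + v ^ 2)) by ring.
  rewrite He, Rmult_1_l; now apply Rmult_lt_0_compat.
Qed.

(** * The shape of horocycles *)

(** On such a circle the distance of a point to the unit circle is controlled by
    its distance to the tangency point:
    [r (1 - |z|^2) = (1 - r) |z - (a, b)|^2]. *)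
Lemma tangent_circle a b r : a ^ 2 + b ^ 2 = 1 -> 0 < r < 1 ->
  internally_tangent ((1 - r) * a) ((1 - r) * b) r a b.
Proof.
intros Hab Hr; unfold internally_tangent, on_circle, D0; split; [lra|split].
- transitivity (r ^ 2 * (a ^ 2 + b ^ 2)); [ring|rewrite Hab; ring].
- intros x y H Hne.
  assert (K : 0 < (x - a) ^ 2 + (y - b) ^ 2).
  { apply square_sum_pos; intros [= K1 K2]; apply Hne; f_equal; lra. }
  assert (E : r * (1 - (x ^ 2 + y ^ 2)) = (1 - r) * ((x - a) ^ 2 + (y - b) ^ 2)).
  { apply Rminus_diag_uniq.
    transitivity (r ^ 2 - ((x - (1 - r) * a) ^ 2 + (y - (1 - r) * b) ^ 2)
                  + r * (1 - r) * (1 - (a ^ 2 + b ^ 2))).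
    - ring.
    - rewrite H, Hab; ring. }
  assert (0 < (1 - r) * ((x - a) ^ 2 + (y - b) ^ 2)) by (apply Rmult_lt_0_compat; lra).
  rewrite <- E in *; nra.
Qed.

(** The reflection of the tangency point in the line joining the two centres lies
    on both circles, so it is the tangency point itself; hence the centre is on
    the radius through it.  That the antipode of the tangency point is in the disk then
    places the centre strictly between the origin and the tangency point. *)
Lemma horocycle_shape h :
  0 < hr h < 1 /\ ha h ^ 2 + hb h ^ 2 = 1 /\
  hp h = (1 - hr h) * ha h /\ hq h = (1 - hr h) * hb h.
Proof.
destruct h as [p q r a b Hc Hr [H1 [H2 H3]]]; simpl.
unfold on_circle, D0 in *.
assert (Hab : a ^ 2 + b ^ 2 = 1) by lra; clear H1.
(* [(a - k q, b + k p)] is the reflection of [(a, b)] in the line through the two centres. *)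
assert (Hcross : a * q - b * p = 0).
{ destruct (Req_dec (a * q - b * p) 0) as [H|H]; [easy|exfalso].
  assert (Hn : 0 < p ^ 2 + q ^ 2).
  { apply square_sum_pos; intros [= -> ->]; lra. }
  set (k := 2 * (a * q - b * p) / (p ^ 2 + q ^ 2)).
  assert (Hk : k * (p ^ 2 + q ^ 2) = 2 * (a * q - b * p)) by (unfold k; field; lra).
  assert (Hk0 : k <> 0) by (intros K; rewrite K in Hk; lra).
  assert (Hn1 : (a - k * q) ^ 2 + (b + k * p) ^ 2 = 1).
  { transitivity (a ^ 2 + b ^ 2 + k * (k * (p ^ 2 + q ^ 2) - 2 * (a * q - b * p))); [ring|].
    rewrite Hk, Hab; ring. }
  assert ((a - k * q) ^ 2 + (b + k * p) ^ 2 < 1); [|lra].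
  apply H3.
  - rewrite <- H2; apply Rminus_diag_uniq.
    transitivity ((a - k * q) ^ 2 + (b + k * p) ^ 2 - (a ^ 2 + b ^ 2)); [ring|lra].
  - intros [= K1 K2].
    assert (k * q = 0) by lra; assert (k * p = 0) by lra.
    assert (k * (p ^ 2 + q ^ 2) = 0); [|lra].
    transitivity (k * q * q + k * p * p); [ring|].
    replace (k * q) with 0; replace (k * p) with 0; ring. }
set (k := a * p + b * q).
assert (Hp : p = k * a).
{ transitivity ((a ^ 2 + b ^ 2) * p); [rewrite Hab; ring|].
  transitivity (k * a - b * (a * q - b * p)); [unfold k; ring|rewrite Hcross; ring]. }
assert (Hq : q = k * b).
{ transitivity ((a ^ 2 + b ^ 2) * q); [rewrite Hab; ring|].
  transitivity (k * b + a * (a * q - b * p)); [unfold k; ring|rewrite Hcross; ring]. }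
clearbody k; subst p q; clear Hcross.
assert (Hk1 : k ^ 2 < 1).
{ replace (k ^ 2) with (k ^ 2 * (a ^ 2 + b ^ 2)) by (rewrite Hab; ring); lra. }
assert (Hkr : (1 - k) ^ 2 = r ^ 2).
{ replace ((1 - k) ^ 2) with ((1 - k) ^ 2 * (a ^ 2 + b ^ 2)) by (rewrite Hab; ring); lra. }
assert (Hr1 : 1 - k = r) by nra.
(* The antipode of the tangency point excludes [k <= 0]. *)
assert (Hanti : (2 * (k * a) - a) ^ 2 + (2 * (k * b) - b) ^ 2 < 1).
{ apply H3; [rewrite <- H2; ring|].
  intros [= K1 K2].
  assert ((1 - k) * (a ^ 2 + b ^ 2) = 0).
  { transitivity (((1 - k) * a) * a + ((1 - k) * b) * b); [ring|].
    replace ((1 - k) * a) with 0 by lra; replace ((1 - k) * b) with 0 by lra; ring. }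
  rewrite Hab in *; lra. }
assert ((2 * k - 1) ^ 2 < 1).
{ replace ((2 * k - 1) ^ 2) with ((2 * k - 1) ^ 2 * (a ^ 2 + b ^ 2)) by (rewrite Hab; ring); lra. }
replace (1 - r) with k by lra; repeat split; auto; nra.
Qed.

(** * Stereographic parametrization of horocycles *)

(** Like [elementary], a class closed under differentiation; it serves for the
    parametrizations and the changes of parameter, which are rational in smooth
    functions. *)
Inductive rational (c : curve) : (R -> R) -> Prop :=
| rat_base f : smooth_curve_fun c f -> rational c f
| rat_const k : rational c (fun _ => k)
| rat_id : rational c (fun t => t)
| rat_plus f g : rational c f -> rational c g -> rational c (fun t => f t + g t)
| rat_mult f g : rational c f -> rational c g -> rational c (fun t => f t * g t)
| rat_inv f : rational c f -> (forall t, dom c t -> f t <> 0) ->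
    rational c (fun t => / f t).

Lemma smooth_Derive c f : smooth_curve_fun c f -> smooth_curve_fun c (Derive f).
Proof.
intros Hf [|n] t Ht; [exact I|].
apply ex_derive_ext with (Derive_n f (S n)).
- intros s; rewrite <- (Nat.add_1_r n), <- Derive_n_comp; reflexivity.
- exact (Hf (S (S n)) t Ht).
Qed.

Lemma rational_derive c f : rational c f ->
  exists g, rational c g /\ forall t, dom c t -> is_derive f t (g t).
Proof.
induction 1 as [f Hf|k| |f g Ef [f' [Ef' Hf]] Eg [g' [Eg' Hg]]
               |f g Ef [f' [Ef' Hf]] Eg [g' [Eg' Hg]]|f Ef [f' [Ef' Hf]] Nf].
- exists (Derive f); split; [now apply rat_base, smooth_Derive|].
  intros t Ht; apply Derive_correct, (Hf 1%nat t Ht).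
- exists (fun _ => 0); split; [apply rat_const|].
  intros t _; apply (is_derive_const (K := R_AbsRing) (V := R_NormedModule)).
- exists (fun _ => 1); split; [apply rat_const|].
  intros t _; apply (is_derive_id (K := R_AbsRing)).
- exists (fun t => f' t + g' t); split; [now apply rat_plus|].
  intros t Ht; apply (is_derive_plus (K := R_AbsRing) (V := R_NormedModule)); auto.
- exists (fun t => f' t * g t + f t * g' t); split.
  { apply rat_plus; now apply rat_mult. }
  intros t Ht; apply (is_derive_mult f g t (f' t) (g' t)); auto.
  intros; apply Rmult_comm.
- exists (fun t => (-1) * f' t * (/ f t * / f t)); split.
  { repeat first [apply rat_mult|apply rat_inv|apply rat_const|assumption]. }
  intros t Ht; evar_last; [apply (is_derive_inv f t (f' t)); auto|].
  field; auto.
Qed.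

Lemma rational_smooth c f : rational c f -> smooth_curve_fun c f.
Proof.
intros Hf.
assert (HD : forall n, exists g, rational c g /\
  forall t, dom c t -> Derive_n f n t = g t).
{ induction n as [|n [g [Eg Hg]]]; [now exists f|].
  destruct (rational_derive c g Eg) as [g' [Eg' Hg']].
  exists g'; split; [easy|]; intros t Ht; apply is_derive_unique.
  apply (is_derive_ext_loc g); [|auto].
  generalize (dom_locally c t Ht); apply filter_imp; intros s Hs; symmetry; auto. }
intros [|n] t Ht; [exact I|].
destruct (HD n) as [g [Eg Hg]]; destruct (rational_derive c g Eg) as [g' [_ Hg']].
apply (ex_derive_ext_loc g).
- generalize (dom_locally c t Ht); apply filter_imp; intros s Hs; symmetry; auto.
- exists (g' t); auto.
Qed.

(** Stereographic projection from the tangency point: with [z] expressed in the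
    orthonormal frame of the tangency point [(a, b)] and [(b, - a)], the line from
    [(a, b)] to [z] has slope [- e * stereo].  The sign makes the parameter increase
    in the sense of rotation [e]. *)
Definition stereo (e : R) (h : horocycle) (x y : R) : R :=
  e * (x * hb h - y * ha h) / (1 - (x * ha h + y * hb h)).

(** The inverse of [stereo].  The tangency point corresponds to infinity. *)
Definition stereo_curve_x (e : R) (h : horocycle) (s : R) : R :=
  ha h - 2 * hr h * (ha h - e * s * hb h) / (1 + s ^ 2).
Definition stereo_curve_y (e : R) (h : horocycle) (s : R) : R :=
  hb h - 2 * hr h * (hb h + e * s * ha h) / (1 + s ^ 2).
Definition stereo_curve (e : R) (h : horocycle) : curve :=
  Curve (stereo_curve_x e h) (stereo_curve_y e h) m_infty p_infty.

Lemma stereo_curve_dom e h s : dom (stereo_curve e h) s.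
Proof. now split. Qed.

Lemma on_horocycle_disk h x y : on_horocycle h x y -> D0 x y.
Proof.
intros [H1 H2]; destruct (h_tangent h) as [_ [_ H3]]; now apply H3.
Qed.

Lemma tangency_gap h x y : D0 x y -> 0 < 1 - (x * ha h + y * hb h).
Proof.
unfold D0; destruct (horocycle_shape h) as [_ [Hab _]]; intros H.
generalize (pow2_ge_0 (x - ha h)), (pow2_ge_0 (y - hb h)); nra.
Qed.

Lemma one_plus_sqr s : 0 < 1 + s ^ 2.
Proof. generalize (pow2_ge_0 s); lra. Qed.

Lemma stereo_curve_on_horocycle e h s : e * e = 1 -> on_horocycle h (stereo_curve_x e h s) (stereo_curve_y e h s).
Proof.
intros He; destruct (horocycle_shape h) as (Hr & Hab & Hp & Hq).
assert (Hs := one_plus_sqr s); unfold on_horocycle, on_circle, stereo_curve_x, stereo_curve_y.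
rewrite Hp, Hq; clear Hp Hq.
set (a := ha h) in *; set (b := hb h) in *; set (r := hr h) in *; clearbody a b r.
split.
- apply Rminus_diag_uniq.
  transitivity (r ^ 2 * (a ^ 2 + b ^ 2 - 1)
     + 4 * r ^ 2 * s ^ 2 / (1 + s ^ 2) ^ 2 * (a ^ 2 + b ^ 2) * (e * e - 1)).
  + field; lra.
  + rewrite Hab, He; ring.
- intros K; apply pair_equal_spec in K; destruct K as [K1 K2].
  assert (K1' : 2 * r * (a - e * s * b) / (1 + s ^ 2) = 0) by lra.
  assert (K2' : 2 * r * (b + e * s * a) / (1 + s ^ 2) = 0) by lra.
  assert (2 * r * (a ^ 2 + b ^ 2) = 0); [|rewrite Hab in *; lra].
  transitivity ((1 + s ^ 2) * (a * (2 * r * (a - e * s * b) / (1 + s ^ 2))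
                               + b * (2 * r * (b + e * s * a) / (1 + s ^ 2)))).
  + field; lra.
  + rewrite K1', K2'; ring.
Qed.

(** The circle equation gives [1 + stereo^2 = 2 r / k] with
    [k = 1 - (x a + y b)], which cancels the denominators of the
    parametrization. *)
Lemma stereo_curve_stereo e h x y : e * e = 1 -> on_horocycle h x y ->
  stereo_curve_x e h (stereo e h x y) = x /\ stereo_curve_y e h (stereo e h x y) = y.
Proof.
intros He Hh; assert (Hk := tangency_gap h x y (on_horocycle_disk h x y Hh)).
destruct Hh as [Hc _]; destruct (horocycle_shape h) as (Hr & Hab & Hp & Hq).
unfold on_circle in Hc; rewrite Hp, Hq in Hc; clear Hp Hq.
assert (Hs := one_plus_sqr (stereo e h x y)).
assert (E : 1 + stereo e h x y ^ 2 = 2 * hr h / (1 - (x * ha h + y * hb h))).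
{ unfold stereo.
  set (a := ha h) in *; set (b := hb h) in *; set (r := hr h) in *; clearbody a b r.
  transitivity (((1 - (x * a + y * b)) ^ 2 + e * e * (x * b - y * a) ^ 2)
                / (1 - (x * a + y * b)) ^ 2); [field; lra|].
  rewrite He; transitivity ((2 * r * (1 - (x * a + y * b))) / (1 - (x * a + y * b)) ^ 2);
    [f_equal|field; lra].
  apply Rminus_diag_uniq.
  transitivity ((x - (1 - r) * a) ^ 2 + (y - (1 - r) * b) ^ 2 - r ^ 2
     + (a ^ 2 + b ^ 2 - 1) * (x ^ 2 + y ^ 2 - (1 - r) ^ 2)); [ring|].
  rewrite Hc, Hab; ring. }
unfold stereo_curve_x, stereo_curve_y; rewrite E; unfold stereo.
set (a := ha h) in *; set (b := hb h) in *; set (r := hr h) in *; clearbody a b r.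
split.
- transitivity (a - a * (1 - (x * a + y * b)) + e * e * (x * b - y * a) * b);
    [field; lra|].
  rewrite He; transitivity (x * (a ^ 2 + b ^ 2)); [ring|rewrite Hab; ring].
- transitivity (b - b * (1 - (x * a + y * b)) - e * e * (x * b - y * a) * a);
    [field; lra|].
  rewrite He; transitivity (y * (a ^ 2 + b ^ 2)); [ring|rewrite Hab; ring].
Qed.

(** * Horocycles are geodesics *)

Definition oriented_horocycle (e : R) (h : horocycle) (c : curve) : Prop :=
  parametrizes h c /\ forall t, dom c t -> 0 < e * rotation h c t.

(** The weakening of [oriented_horocycle] satisfied by a curve that covers only a
    part of the horocycle. *)
Definition runs_along (e : R) (h : horocycle) (c : curve) : Prop :=
  forall t, dom c t -> on_horocycle h (cx c t) (cy c t) /\ 0 < e * rotation h c t.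

Lemma oriented_runs_along e h c : oriented_horocycle e h c -> runs_along e h c.
Proof.
intros [[_ Hp] Hr] t Ht; split; [|auto]; apply Hp; now exists t.
Qed.

Lemma horocycle_of_circle p q r : 0 < r < 1 -> p ^ 2 + q ^ 2 = (1 - r) ^ 2 ->
  exists h, hp h = p /\ hq h = q /\ hr h = r.
Proof.
intros Hr Hpq; set (a := p / (1 - r)); set (b := q / (1 - r)).
assert (Hp : p = (1 - r) * a) by (unfold a; field; lra).
assert (Hq : q = (1 - r) * b) by (unfold b; field; lra).
assert (Hab : a ^ 2 + b ^ 2 = 1).
{ transitivity ((p ^ 2 + q ^ 2) / (1 - r) ^ 2); [unfold a, b; field; lra|].
  rewrite Hpq; field; lra. }
assert (HD : D0 p q) by (unfold D0; rewrite Hpq; nra).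
assert (HT : internally_tangent p q r a b)
  by (rewrite Hp, Hq; now apply tangent_circle).
now exists (Horocycle p q r a b HD (proj1 Hr) HT).
Qed.

Lemma on_horocycle_in_disk h x y :
  on_circle (hp h) (hq h) (hr h) x y -> D0 x y -> on_horocycle h x y.
Proof.
intros H1 H2; split; [easy|]; intros [= -> ->].
destruct (horocycle_shape h) as (_ & Hab & _); unfold D0 in H2; lra.
Qed.

(** The osculating horocycle at one time is the osculating horocycle at all
    times, and each point of the curve lies on the one at its own time. *)
Lemma geodesic_runs_along_horocycle e c : e * e = 1 -> geodesic D0 (G e) c ->
  exists h, runs_along e h c.
Proof.
intros He [Hc HE]; assert (Hg := proj1 (geodesic_eq_iff e c He Hc) HE).
destruct (dom_nonempty c (proj1 Hc)) as [t0 Ht0].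
assert (Hconst : forall t, dom c t ->
  along (osc_p e) c t = along (osc_p e) c t0 /\
  along (osc_q e) c t = along (osc_q e) c t0 /\
  along (osc_r e) c t = along (osc_r e) c t0).
{ intros t Ht; split; [|split]; apply (constant_on_dom c); auto; intros s Hs;
    now apply (osculating_derive e c s He Hc Hs (Hg s Hs)). }
destruct (osculating_circle e _ _ _ _ He (curve_slit c t0 Hc Ht0)) as (Hr & Hpq & _).
destruct (horocycle_of_circle _ _ _ Hr Hpq) as (h & Ep & Eq & Er).
exists h; intros t Ht.
destruct (osculating_circle e _ _ _ _ He (curve_slit c t Hc Ht)) as (_ & _ & Ho & HR).
destruct (Hconst t Ht) as (Cp & Cq & Cr); unfold along in Cp, Cq, Cr.
rewrite Cp, Cq in HR; rewrite Cp, Cq, Cr in Ho.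
rewrite <- Ep, <- Eq in HR; rewrite <- Ep, <- Eq, <- Er in Ho.
split; [|exact HR]; apply on_horocycle_in_disk; [easy|now apply Hc].
Qed.

Lemma circle_derive h c t : regular_curve D0 c ->
  (forall t, dom c t -> on_horocycle h (cx c t) (cy c t)) -> dom c t ->
  (cx c t - hp h) * Derive (cx c) t + (cy c t - hq h) * Derive (cy c) t = 0.
Proof.
intros Hc Hh Ht; destruct (curve_derive c t Hc Ht) as (Dx & Dy & _).
assert (H : is_derive (fun s => (cx c s - hp h) ^ 2 + (cy c s - hq h) ^ 2) t 0).
{ apply (is_derive_ext_loc (fun _ => hr h ^ 2)).
  - generalize (dom_locally c t Ht); apply filter_imp; intros s Hs.
    symmetry; now apply Hh.
  - apply (is_derive_const (K := R_AbsRing) (V := R_NormedModule)). }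
apply is_derive_unique in H.
assert (E : Derive (fun s => (cx c s - hp h) ^ 2 + (cy c s - hq h) ^ 2) t
   = 2 * ((cx c t - hp h) * Derive (cx c) t + (cy c t - hq h) * Derive (cy c) t)).
{ apply is_derive_unique; evar_last; [auto_derive; [|reflexivity]|].
  - repeat split; eexists; eassumption.
  - replace_derivatives; simpl; ring. }
assert (E' := eq_trans (eq_sym E) H); lra.
Qed.

(** The hypotheses are the circle equation and its first two derivatives.  They give
    [e R = r s] for the rotation [R], then [J = e s^3 / r]; the
    condition on the centre gives [s D = 2 r (s + e (y u - x v))]. *)
Lemma circle_geodesic_identity e p q r x y u v u' v' s :
  e * e = 1 -> 0 < r -> p ^ 2 + q ^ 2 = (1 - r) ^ 2 ->
  (x - p) ^ 2 + (y - q) ^ 2 = r ^ 2 ->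
  (x - p) * u + (y - q) * v = 0 ->
  u ^ 2 + v ^ 2 + (x - p) * u' + (y - q) * v' = 0 ->
  0 < e * ((x - p) * v - (y - q) * u) -> 0 < s -> s ^ 2 = u ^ 2 + v ^ 2 ->
  (u * v' - v * u') * conf x y = 2 * e * s ^ 2 * (s + e * (y * u - x * v)).
Proof.
intros He Hr Hpq Hc H1 H2 HR Hs Hq.
set (X := x - p) in *; set (Y := y - q) in *.
assert (Ex : x = X + p) by (unfold X; ring); assert (Ey : y = Y + q) by (unfold Y; ring).
clearbody X Y; subst x y.
set (R := X * v - Y * u) in *.
assert (Hu : r ^ 2 * u = - (R * Y)).
{ rewrite <- Hc; transitivity (X * (X * u + Y * v) - R * Y); [unfold R; ring|].
  rewrite H1; ring. }
assert (Hv : r ^ 2 * v = R * X).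
{ rewrite <- Hc; transitivity (Y * (X * u + Y * v) + R * X); [unfold R; ring|].
  rewrite H1; ring. }
assert (HRs : e * R = r * s).
{ assert (E : (e * R) ^ 2 = (r * s) ^ 2).
  { transitivity (e * e * R ^ 2); [ring|]; rewrite He.
    transitivity (r ^ 2 * s ^ 2); [|ring]; rewrite <- Hc, Hq.
    transitivity (R ^ 2 + (X * u + Y * v) ^ 2); [rewrite H1; ring|unfold R; ring]. }
  assert (0 < r * s) by now apply Rmult_lt_0_compat.
  apply Rsqr_inj; try lra; rewrite !Rsqr_pow2; exact E. }
assert (HR' : R = e * r * s).
{ transitivity (e * e * R); [rewrite He; ring|].
  transitivity (e * (e * R)); [ring|rewrite HRs; ring]. }
clearbody R.
assert (HJ : r ^ 2 * (u * v' - v * u') = R * s ^ 2).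
{ transitivity (r ^ 2 * u * v' - r ^ 2 * v * u'); [ring|]; rewrite Hu, Hv, Hq.
  transitivity (R * (u ^ 2 + v ^ 2) - R * (u ^ 2 + v ^ 2 + X * u' + Y * v')); [ring|].
  rewrite H2; ring. }
assert (HDf : conf (X + p) (Y + q) = 2 * r * (1 - r) - 2 * (p * X + q * Y)).
{ unfold conf.
  transitivity (1 - (X ^ 2 + Y ^ 2) - (p ^ 2 + q ^ 2) - 2 * (p * X + q * Y)); [ring|].
  rewrite Hc, Hpq; ring. }
assert (HS : r ^ 2 * (s + e * ((Y + q) * u - (X + p) * v))
             = r * s * (r - r ^ 2 - (p * X + q * Y))).
{ transitivity (r ^ 2 * s + e * ((Y + q) * (r ^ 2 * u) - (X + p) * (r ^ 2 * v))); [ring|].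
  rewrite Hu, Hv.
  transitivity (r ^ 2 * s - (e * R) * (X ^ 2 + Y ^ 2 + (p * X + q * Y))); [ring|].
  rewrite HRs, Hc; ring. }
apply (Rmult_eq_reg_l (r ^ 2)); [|apply Rgt_not_eq; now apply pow_lt].
transitivity (r ^ 2 * (u * v' - v * u') * conf (X + p) (Y + q)); [ring|].
transitivity (2 * e * s ^ 2 * (r ^ 2 * (s + e * ((Y + q) * u - (X + p) * v)))); [|ring].
rewrite HJ, HS, HDf, HR'; ring.
Qed.

Lemma runs_along_geodesic e h c : e * e = 1 -> regular_curve D0 c ->
  runs_along e h c -> geodesic D0 (G e) c.
Proof.
intros He Hc Hh; split; [easy|]; apply geodesic_eq_iff; auto; intros t Ht.
assert (Hon : forall s, dom c s -> on_horocycle h (cx c s) (cy c s)) by (intros; now apply Hh).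
assert (HW := curve_slit c t Hc Ht).
destruct (curve_derive c t Hc Ht) as (Dx & Dy & Du & Dv).
destruct (horocycle_shape h) as (Hr & Hab & Hp & Hq).
assert (H2 : is_derive (fun s => (cx c s - hp h) * Derive (cx c) s
                 + (cy c s - hq h) * Derive (cy c) s) t 0).
{ apply (is_derive_ext_loc (fun _ => 0)).
  - generalize (dom_locally c t Ht); apply filter_imp; intros s Hs.
    symmetry; now apply circle_derive.
  - apply (is_derive_const (K := R_AbsRing) (V := R_NormedModule)). }
apply is_derive_unique in H2.
assert (E : Derive (fun s => (cx c s - hp h) * Derive (cx c) s
                 + (cy c s - hq h) * Derive (cy c) s) t
   = Derive (cx c) t ^ 2 + Derive (cy c) t ^ 2
     + (cx c t - hp h) * ddx c t + (cy c t - hq h) * ddy c t).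
{ apply is_derive_unique; evar_last; [auto_derive; [|reflexivity]|].
  - repeat split; eexists; eassumption.
  - replace_derivatives; simpl; ring. }
assert (E' := eq_trans (eq_sym E) H2).
unfold geodesic_eq, along, twisted_speed.
apply (circle_geodesic_identity e (hp h) (hq h) (hr h)); auto; try lra.
- rewrite Hp, Hq; transitivity ((1 - hr h) ^ 2 * (ha h ^ 2 + hb h ^ 2));
    [ring|rewrite Hab; ring].
- now apply Hon.
- now apply circle_derive.
- now apply Hh.
- now apply (speed_pos (cx c t) (cy c t)).
- apply speed_sqr.
Qed.

(** The derivative of [stereo] along the curve is [e R / (r k)], where [R] is the
    rotation and [k = 1 - (x a + y b)] is positive in the disk. *)
Lemma stereo_reparam e h c : e * e = 1 -> regular_curve D0 c -> runs_along e h c ->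
  reparam (fun t => stereo e h (cx c t) (cy c t)) c (stereo_curve e h).
Proof.
intros He Hc Hh.
assert (Hon : forall s, dom c s -> on_horocycle h (cx c s) (cy c s)) by (intros; now apply Hh).
assert (Hk : forall t, dom c t -> 0 < 1 - (cx c t * ha h + cy c t * hb h)).
{ intros t Ht; now apply tangency_gap, (on_horocycle_disk h), Hon. }
destruct (horocycle_shape h) as (Hr & Hab & Hp & Hq).
split; [|split; [|split]].
- apply rational_smooth.
  assert (Rx : rational c (cx c)) by now apply rat_base, Hc.
  assert (Ry : rational c (cy c)) by now apply rat_base, Hc.
  replace (fun t => stereo e h (cx c t) (cy c t)) with
    (fun t => (e * (hb h * cx c t + - ha h * cy c t)) *
              / (1 + (- ha h * cx c t + - hb h * cy c t))).
  2: { apply functional_extensionality; intros t; unfold stereo, Rdiv.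
       f_equal; [ring|f_equal; ring]. }
  repeat first [apply rat_mult|apply rat_plus|apply rat_inv|apply rat_const|assumption].
  intros t Ht; specialize (Hk t Ht); lra.
- intros t Ht; specialize (Hk t Ht); destruct (Hh t Ht) as [[Hcirc _] HR].
  assert (H1 := circle_derive h c t Hc Hon Ht).
  destruct (curve_derive c t Hc Ht) as (Dx & Dy & _).
  unfold on_circle in Hcirc; unfold rotation in HR.
  set (k := 1 - (cx c t * ha h + cy c t * hb h)) in *.
  set (R := (cx c t - hp h) * Derive (cy c) t - (cy c t - hq h) * Derive (cx c) t) in *.
  assert (E : hr h * ((cx c t - ha h) * Derive (cy c) t - (cy c t - hb h) * Derive (cx c) t)
              = R * k).
  { apply (Rmult_eq_reg_l (hr h)); [|lra].
    set (X := cx c t - hp h) in *; set (Y := cy c t - hq h) in *.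
    set (u := Derive (cx c) t) in *; set (v := Derive (cy c) t) in *.
    assert (Ek : hr h - (ha h * X + hb h * Y) = k).
    { unfold X, Y, k; rewrite Hp, Hq.
      transitivity (hr h - (cx c t * ha h + cy c t * hb h)
                    + (1 - hr h) * (ha h ^ 2 + hb h ^ 2)); [ring|rewrite Hab; ring]. }
    assert (Ev : hr h ^ 2 * (ha h * v - hb h * u) = R * (ha h * X + hb h * Y)).
    { rewrite <- Hcirc; apply Rminus_diag_uniq.
      transitivity ((ha h * Y - hb h * X) * (X * u + Y * v)); [unfold R; ring|].
      rewrite H1; ring. }
    transitivity (hr h ^ 2 * R - hr h * (hr h ^ 2 * (ha h * v - hb h * u))).
    - replace (cx c t - ha h) with (X - hr h * ha h) by (unfold X; rewrite Hp; ring).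
      replace (cy c t - hb h) with (Y - hr h * hb h) by (unfold Y; rewrite Hq; ring).
      unfold R; ring.
    - rewrite Ev, <- Ek; ring. }
  replace (Derive _ t) with (e * R / (hr h * k)).
  { apply Rdiv_lt_0_compat; [easy|]; apply Rmult_lt_0_compat; lra. }
  symmetry; apply is_derive_unique; unfold stereo.
  evar_last; [auto_derive; [|reflexivity]|].
  + repeat split; try (eexists; eassumption); unfold k in Hk; lra.
  + replace_derivatives.
    replace (e * R / (hr h * k)) with (e * (R * k) / (hr h * k ^ 2)) by (field; lra).
    rewrite <- E; unfold k in Hk |- *.
    set (x := cx c t) in *; set (y := cy c t) in *.
    set (u := Derive (cx c) t) in *; set (v := Derive (cy c) t) in *.
    transitivity (e * ((x * v - y * u) * (ha h ^ 2 + hb h ^ 2) - (ha h * v - hb h * u))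
                  / (1 - (x * ha h + y * hb h)) ^ 2); [field; lra|].
    rewrite Hab; field; lra.
- intros t _; apply stereo_curve_dom.
- intros t Ht; destruct (stereo_curve_stereo e h _ _ He (Hon t Ht)) as [E1 E2]; simpl; auto.
Qed.

(** * Whole horocycles and maximality *)

Lemma stereo_curve_smooth e h :
  smooth_curve_fun (stereo_curve e h) (stereo_curve_x e h) /\
  smooth_curve_fun (stereo_curve e h) (stereo_curve_y e h).
Proof.
assert (Hs := one_plus_sqr).
split; apply rational_smooth.
- replace (stereo_curve_x e h) with (fun s =>
    ha h + (-2 * hr h * ha h + 2 * hr h * e * hb h * s) * / (1 + s * s)).
  2: { apply functional_extensionality; intros s; unfold stereo_curve_x; field.
       specialize (Hs s); lra. }
  repeat first [apply rat_const|apply rat_plus|apply rat_mult|apply rat_inv|apply rat_id].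
  intros s _; specialize (Hs s); lra.
- replace (stereo_curve_y e h) with (fun s =>
    hb h + (-2 * hr h * hb h + - 2 * hr h * e * ha h * s) * / (1 + s * s)).
  2: { apply functional_extensionality; intros s; unfold stereo_curve_y; field.
       specialize (Hs s); lra. }
  repeat first [apply rat_const|apply rat_plus|apply rat_mult|apply rat_inv|apply rat_id].
  intros s _; specialize (Hs s); lra.
Qed.

Lemma stereo_curve_rotation e h s : rotation h (stereo_curve e h) s = 2 * e * hr h ^ 2 / (1 + s ^ 2).
Proof.
destruct (horocycle_shape h) as (Hr & Hab & Hp & Hq).
assert (Hs := one_plus_sqr s); unfold rotation; simpl cx; simpl cy.
assert (Dx : Derive (stereo_curve_x e h) s =
  2 * hr h * (e * hb h * (1 - s ^ 2) + 2 * s * ha h) / (1 + s ^ 2) ^ 2).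
{ apply is_derive_unique; unfold stereo_curve_x.
  evar_last; [auto_derive; [|reflexivity]|]; [simpl in Hs; lra|field; lra]. }
assert (Dy : Derive (stereo_curve_y e h) s =
  2 * hr h * (2 * s * hb h - e * ha h * (1 - s ^ 2)) / (1 + s ^ 2) ^ 2).
{ apply is_derive_unique; unfold stereo_curve_y.
  evar_last; [auto_derive; [|reflexivity]|]; [simpl in Hs; lra|field; lra]. }
rewrite Dx, Dy, Hp, Hq; unfold stereo_curve_x, stereo_curve_y.
transitivity (2 * e * hr h ^ 2 * (ha h ^ 2 + hb h ^ 2) / (1 + s ^ 2));
  [field; lra|rewrite Hab; field; lra].
Qed.

Lemma stereo_curve_oriented e h : e * e = 1 -> oriented_horocycle e h (stereo_curve e h).
Proof.
intros He.
assert (Hrot : forall s, 0 < e * rotation h (stereo_curve e h) s).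
{ intros s; rewrite stereo_curve_rotation; destruct (horocycle_shape h) as (Hr & _).
  replace (e * _) with (e * e * (2 * hr h ^ 2 / (1 + s ^ 2)))
    by (field; apply Rgt_not_eq, one_plus_sqr).
  rewrite He, Rmult_1_l; apply Rdiv_lt_0_compat; [|apply one_plus_sqr].
  apply Rmult_lt_0_compat; [lra|now apply pow_lt]. }
split; [split|auto].
- destruct (stereo_curve_smooth e h) as [Sx Sy].
  split; [exact I|]; split; [exact Sx|]; split; [exact Sy|]; split.
  + intros s _; apply (on_horocycle_disk h); now apply stereo_curve_on_horocycle.
  + intros s _ H; apply pair_equal_spec in H; destruct H as [H1 H2].
    specialize (Hrot s); unfold rotation in Hrot; rewrite H1, H2 in Hrot; lra.
- intros x y; split.
  + intros H; exists (stereo e h x y); split; [apply stereo_curve_dom|now apply stereo_curve_stereo].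
  + intros [s [_ [<- <-]]]; now apply stereo_curve_on_horocycle.
Qed.

Lemma reparam_injective phi c c' s t : reparam phi c c' -> dom c s -> dom c t ->
  phi s = phi t -> s = t.
Proof.
intros (Hsm & Hpos & _).
assert (Hincr : forall a b, dom c a -> dom c b -> a < b -> phi a < phi b).
{ intros a b [Ha _] [_ Hb] Hab.
  apply (incr_function phi (lo c) (hi c) (Derive phi)); auto.
  - intros x H1 H2; apply Derive_correct; now apply (Hsm 1%nat).
  - intros x H1 H2; apply Hpos; now split. }
intros Hs Ht E; destruct (Rtotal_order s t) as [H|[H|H]]; [|easy|].
- generalize (Hincr s t Hs Ht H); lra.
- generalize (Hincr t s Ht Hs H); lra.
Qed.

(** Three points determine a circle: those at parameters [0], [1] and [-1] are the
    point opposite to the tangency point and the two ends of the perpendicular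
    diameter. *)
Lemma horocycle_inclusion h h' :
  (forall x y, on_horocycle h x y -> on_horocycle h' x y) ->
  forall x y, on_horocycle h' x y -> on_horocycle h x y.
Proof.
intros Hincl.
assert (H1 : 1 * 1 = 1) by ring.
destruct (horocycle_shape h) as (Hr & Hab & Hp & Hq).
destruct (horocycle_shape h') as (Hr' & _).
destruct (Hincl _ _ (stereo_curve_on_horocycle 1 h 0 H1)) as [K0 _].
destruct (Hincl _ _ (stereo_curve_on_horocycle 1 h 1 H1)) as [K1 _].
destruct (Hincl _ _ (stereo_curve_on_horocycle 1 h (-1) H1)) as [K2 _].
unfold on_circle, stereo_curve_x, stereo_curve_y in K0, K1, K2.
set (d1 := hp h - hp h'); set (d2 := hq h - hq h').
assert (L0 : (d1 - hr h * ha h) ^ 2 + (d2 - hr h * hb h) ^ 2 = hr h' ^ 2).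
{ rewrite <- K0; unfold d1, d2; rewrite Hp, Hq; field. }
assert (L1 : (d1 + hr h * hb h) ^ 2 + (d2 - hr h * ha h) ^ 2 = hr h' ^ 2).
{ rewrite <- K1; unfold d1, d2; rewrite Hp, Hq; field. }
assert (L2 : (d1 - hr h * hb h) ^ 2 + (d2 + hr h * ha h) ^ 2 = hr h' ^ 2).
{ rewrite <- K2; unfold d1, d2; rewrite Hp, Hq; field. }
assert (M1 : d1 * hb h - d2 * ha h = 0).
{ apply (Rmult_eq_reg_l (hr h)); lra. }
assert (M2 : d1 ^ 2 + d2 ^ 2 + hr h ^ 2 * (ha h ^ 2 + hb h ^ 2) = hr h' ^ 2) by lra.
assert (M3 : d1 * ha h + d2 * hb h = 0).
{ apply (Rmult_eq_reg_l (hr h)); lra. }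
assert (E1 : d1 = 0).
{ transitivity (d1 * (ha h ^ 2 + hb h ^ 2)); [rewrite Hab; ring|].
  transitivity (ha h * (d1 * ha h + d2 * hb h) + hb h * (d1 * hb h - d2 * ha h)); [ring|].
  rewrite M1, M3; ring. }
assert (E2 : d2 = 0).
{ transitivity (d2 * (ha h ^ 2 + hb h ^ 2)); [rewrite Hab; ring|].
  transitivity (hb h * (d1 * ha h + d2 * hb h) - ha h * (d1 * hb h - d2 * ha h)); [ring|].
  rewrite M1, M3; ring. }
assert (Er : hr h = hr h').
{ rewrite E1, E2, Hab in M2; nra. }
unfold d1 in E1; unfold d2 in E2.
intros x y Hxy; apply on_horocycle_in_disk; [|now apply (on_horocycle_disk h')].
destruct Hxy as [Hxy _].
replace (hp h) with (hp h') by lra; replace (hq h) with (hq h') by lra.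
now rewrite Er.
Qed.

(** An extension of [c] lies on a horocycle containing that of [c], hence on the same
    one, so each of its points is already a point of [c]; a geodesic meets each
    point of its horocycle at most once. *)
Lemma oriented_horocycle_maximal e h c : e * e = 1 ->
  oriented_horocycle e h c -> maximal_geodesic D0 (G e) c.
Proof.
intros He Hc; assert (Hrun := oriented_runs_along e h c Hc).
destruct Hc as [[Hreg Himg] _].
split; [now apply (runs_along_geodesic e h)|].
intros c' phi Hc' (_ & _ & Hdom & Hphi) s Hs.
destruct (geodesic_runs_along_horocycle e c' He Hc') as [h' Hrun'].
assert (Hincl : forall x y, on_horocycle h x y -> on_horocycle h' x y).
{ intros x y Hxy; apply Himg in Hxy; destruct Hxy as [t [Ht [<- <-]]].
  destruct (Hphi t Ht) as [-> ->]; apply Hrun'; auto. }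
assert (Hon := horocycle_inclusion h h' Hincl _ _ (proj1 (Hrun' s Hs))).
apply Himg in Hon; destruct Hon as [t [Ht [E1 E2]]].
exists t; split; [easy|].
destruct (Hphi t Ht) as [F1 F2].
apply (reparam_injective _ c' (stereo_curve e h') _ _ (stereo_reparam e h' c' He (proj1 Hc') Hrun'));
  auto.
now rewrite <- F1, <- F2, E1, E2.
Qed.

(** A geodesic is a part of the stereographic parametrization of its horocycle,
    which is itself a geodesic; maximality forces the two to have the same
    image. *)
Lemma maximal_geodesic_oriented_horocycle e c : e * e = 1 ->
  maximal_geodesic D0 (G e) c -> exists h, oriented_horocycle e h c.
Proof.
intros He [Hc Hmax].
destruct (geodesic_runs_along_horocycle e c He Hc) as [h Hrun].
exists h; split; [split; [apply Hc|]|intros t Ht; now apply Hrun].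
assert (Hrep := stereo_reparam e h c He (proj1 Hc) Hrun).
assert (Hstd : geodesic D0 (G e) (stereo_curve e h)).
{ destruct (stereo_curve_oriented e h He) as [[Hreg _] _].
  apply (runs_along_geodesic e h); auto.
  now apply oriented_runs_along, stereo_curve_oriented. }
intros x y; split.
- intros Hxy.
  destruct (Hmax _ _ Hstd Hrep (stereo e h x y) (stereo_curve_dom e h _)) as [t [Ht E]].
  exists t; split; [easy|].
  destruct (stereo_curve_stereo e h _ _ He (proj1 (Hrun t Ht))) as [E1 E2].
  rewrite E in E1, E2; rewrite <- E1, <- E2; now apply stereo_curve_stereo.
- intros [t [Ht [<- <-]]]; now apply Hrun.
Qed.

Lemma geodesics_of_G e (O : horocycle -> curve -> Prop) : e * e = 1 ->
  (forall h c, O h c <-> oriented_horocycle e h c) ->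
  geodesics_are_horocycles (G e) O.
Proof.
intros He HO; split; [|split].
- intros c; split.
  + intros Hc; destruct (maximal_geodesic_oriented_horocycle e c He Hc) as [h Hh].
    exists h; now apply HO.
  + intros [h Hh]; apply (oriented_horocycle_maximal e h c He); now apply HO.
- intros h; exists (stereo_curve e h); apply HO; now apply stereo_curve_oriented.
- intros c Hc; destruct (geodesic_runs_along_horocycle e c He Hc) as [h Hh].
  exists h, (stereo_curve e h); split; [apply HO; now apply stereo_curve_oriented|].
  eexists; exact (stereo_reparam e h c He (proj1 Hc) Hh).
Qed.

Theorem mainTheorem2 :
  (finsler D0 F /\ geodesics_are_horocycles F anticlockwise_horocycle) /\
  (finsler D0 Fbar /\ geodesics_are_horocycles Fbar clockwise_horocycle).
Proof.
assert (EF : F = G 1).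
{ do 4 (apply functional_extensionality; intros ?).
  unfold F, G, twisted_speed, speed, conf; f_equal; ring. }
assert (EFbar : Fbar = G (-1)).
{ do 4 (apply functional_extensionality; intros ?).
  unfold Fbar, G, twisted_speed, speed, conf; f_equal; ring. }
rewrite EF, EFbar; split; (split; [apply G_finsler; ring|apply geodesics_of_G; [ring|]]).
- intros h c; split; intros [H1 H2]; split; auto; intros t Ht; specialize (H2 t Ht); lra.
- intros h c; split; intros [H1 H2]; split; auto; intros t Ht; specialize (H2 t Ht); lra.
Qed.
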